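(* Let $\alpha$ be real with $1\le\alpha<\infty$, and let $f$ be a log-concave probability density function on $\mathbb{R}$ with finite $\sigma_\alpha$. Put $C_\alpha=\frac{2}{\alpha}\Gamma\left(\frac{1}{\alpha}\right)(\alpha e)^{1/\alpha}$ and $D_\alpha=\Gamma(\alpha+1)^{1/\alpha}$. Then for all $1\le p\le\infty$ and $1\le q\le\infty$, $$\|f\|_p\le C_\alpha^{1-\frac1q}\,D_\alpha^{1-\frac1p}\,\sigma_\alpha^{\frac1p-\frac1q}\,\|f\|_q .$$ Moreover, when $\alpha=2$, writing $\sigma=\sigma_2$, the inequality can be tightened to $$\|f\|_p\le C_2^{1-\frac1q}\,\sigma^{\frac1p-\frac1q}\,\|f\|_q$$ for all $1\le p\le\infty$ and $1\le q\le\infty$.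
   Context: A probability density function (pdf, with respect to Lebesgue measure) $f:\mathbb{R}^n\to\mathbb{R}$ is log-concave if $f(\theta x+(1-\theta)y)\ge f(x)^\theta f(y)^{1-\theta}$ for all $x,y\in\mathbb{R}^n$ and $0\le\theta\le1$; here $n=1$. For $1\le p<\infty$, $\|f\|_p=\left(\int_{\mathbb{R}} f(x)^p\,dx\right)^{1/p}$, and $\|f\|_\infty=\operatorname{ess\,sup}_{x\in\mathbb{R}}|f(x)|$ (Lebesgue measure). Convention: $1/\infty=0$. For a random variable $X$ with pdf $f$, $\sigma_\alpha=\left(E\left[|X-E[X]|^\alpha\right]\right)^{1/\alpha}$. $\Gamma$ is the gamma function. *)

(* Defs.v *)
From HB Require Import structures.
From mathcomp Require Import all_boot all_order all_algebra.
From mathcomp Require Import all_classical all_reals all_analysis.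
Import Order.TTheory GRing.Theory Num.Theory.
Import numFieldNormedType.Exports.

Set Implicit Arguments.
Unset Strict Implicit.
Unset Printing Implicit Defensive.

Local Open Scope classical_set_scope.
Local Open Scope ring_scope.

Definition is_pdf (R : realType) (f : R -> R) : Prop :=
  [/\ measurable_fun [set: R] f,
      forall x, 0 <= f x
    & (\int[lebesgue_measure]_x (f x)%:E = 1)%E].

(* For the degenerate weights theta = 0, 1, the convention 0 `^ 0 = 1 of powR
   makes the inequality trivial, also where f vanishes. *)
Definition log_concave (R : realType) (f : R -> R) : Prop :=
  forall x y theta : R, 0 <= theta <= 1 ->
    f x `^ theta * f y `^ (1 - theta) <= f (theta * x + (1 - theta) * y).

Definition has_pdf (d : measure_display) (T : measurableType d) (R : realType)
    (P : probability T R) (X : {RV P >-> R}) (f : R -> R) : Prop :=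
  forall A : set R, measurable A ->
    distribution P X A = (\int[lebesgue_measure]_(x in A) (f x)%:E)%E.

(* The expectation is extended-real valued, and fine sends infinite values to
   0. This does no harm for alpha >= 1: if the value below is finite, then
   |X - c|^alpha is integrable for some real c, hence so is X, and the centre
   is the actual mean. *)
Definition sigma (d : measure_display) (T : measurableType d) (R : realType)
    (P : probability T R) (X : {RV P >-> R}) (alpha : R) : \bar R :=
  ('E_P[fun t => (`|X t - fine 'E_P[X]| `^ alpha)%R] `^ alpha^-1)%E.

(* Euler's integral; it converges for s > 0, the only case used. *)
Definition Gamma (R : realType) (s : R) : R :=
  \int[lebesgue_measure]_(t in `]0, +oo[) (t `^ (s - 1) * expR (- t)).

Definition Cconst (R : realType) (alpha : R) : R :=
  2 / alpha * Gamma alpha^-1 * (alpha * expR 1) `^ alpha^-1.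

Definition Dconst (R : realType) (alpha : R) : R :=
  Gamma (alpha + 1) `^ alpha^-1.

(* 1/p for an exponent p in [1, +oo], with +oo^-1 = 0. *)
Definition rinv (R : realType) (p : \bar R) : R := fine (p^-1)%E.

Definition pnorm (R : realType) (p : \bar R) (f : R -> R) : \bar R :=
  'N[lebesgue_measure]_p[EFin \o f]%E.

(* Main.v *)
Require Import Defs.
From HB Require Import structures.
From mathcomp Require Import all_boot all_order all_algebra.
From mathcomp Require Import all_classical all_reals all_analysis.
From mathcomp Require Import measurable_realfun ess_sup_inf.
From mathcomp Require Import ring lra.
Import Order.TTheory GRing.Theory Num.Theory.
Import numFieldNormedType.Exports.

Local Open Scope classical_set_scope.
Local Open Scope ring_scope.

(** The upper bound on [‖f‖_p] comes from [f <= D / sigma]; the lower bound on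
    [‖f‖_q] from maximum entropy.

    Upper bound. Let [Y] be an independent copy of [X]. By Jensen,
    [E|X - E X|^a <= E|X - Y|^a], and [Var X = E|X - Y|^2 / 2], which is where the
    better constant for [a = 2] comes from. So it is enough that
    [f(m)^a E|X - Y|^a <= Gamma(a + 1)] for every [m]. Put [A = P(X > m)] and
    [B = P(X < m)]. Above any [x >= m] the density crosses the exponential density
    of the same mass and of rate [f(m) / A] only once, hence
    [E[(X - x)^a ; X > x] <= Gamma(a + 1) (A / f(m))^a P(X > x)], and symmetrically
    below [m]. Pairs on the same side of [m] thus contribute at most
    [(A^2 + B^2) Gamma(a + 1) / f(m)^a]; for pairs on opposite sides, convexity of
    [u^a] with weights [A] and [B] gives at most [2AB Gamma(a + 1) / f(m)^a].

    Lower bound. With [S = 1 / (C sigma)] and [g] the density proportional to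
    [exp(-|x - E X|^a / (a sigma^a))], the inequality [1 + u <= e^u], applied to
    [(q - 1) ln(f / S)] and to [ln(g / f)], integrates to [S^(q-1) <= \int f^q]. *)

(** A bound [f <= M] gives [‖f‖_p <= M^(1-1/p)], and the entropy bound gives [‖f‖_q >= S^(1-1/q)].
    With [M = K / sigma] and [S = 1 / (C sigma)] the powers of [sigma] combine to [1/p - 1/q]. Here
    [K = D] in general; for [a = 2] the pairwise bound reads [2 sigma^2 f(m)^2 <= Gamma(3) <= 2], so
    [K = 1].

    The mean has no controlled position relative to [m]. Passing to pairs removes it: a pair is
    classified only by the sides of [m] on which its points lie.

    The single crossing is forced only by a comparison exponential of strictly larger mass. Hence
    [f(m)] is replaced by an arbitrary [r < f(m)], the slack [1/r - 1/f(m)] is shared between the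
    two sides of [m], and [r] tends to [f(m)] at the very end.

    In the lower bound the logarithm of [f] cancels pointwise, before integration, so integrability
    of [f ln f] is never at issue. The constant [C] comes from the entropy of [g], which is
    [ln(C sigma)]. *)

Ltac mfun :=
  repeat match goal with |- measurable_fun _ _ =>
    first [ assumption | by [] | exact: measurable_powR | exact: measurable_expR
          | exact: oppr_measurable | exact: normr_measurable
          | apply: measurable_funD | apply: measurable_funM ]
  end.

(** * Integrals of nonnegative real functions *)

Section integral_EFin.
Context {R : realType}.
Local Notation mu := (@lebesgue_measure R).
Local Open Scope ereal_scope.

Lemma ge0_integralZl_real (D : set R) (k : R) (g : R -> R) : measurable D ->
  measurable_fun [set: R] g -> (forall x, D x -> (0 <= g x)%R) -> (0 <= k)%R ->
  \int[mu]_(x in D) (k * g x)%:E = k%:E * \int[mu]_(x in D) (g x)%:E.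
Proof.
move=> mD mg g0 k0; under eq_integral do rewrite EFinM.
by rewrite ge0_integralZl//; apply/measurable_EFinP; exact: measurable_funTS.
Qed.

Lemma ge0_integralD_real (D : set R) (g h : R -> R) : measurable D ->
  measurable_fun [set: R] g -> measurable_fun [set: R] h ->
  (forall x, D x -> (0 <= g x)%R) -> (forall x, D x -> (0 <= h x)%R) ->
  \int[mu]_(x in D) (g x + h x)%:E =
  \int[mu]_(x in D) (g x)%:E + \int[mu]_(x in D) (h x)%:E.
Proof.
move=> mD mg mh g0 h0; under eq_integral do rewrite EFinD.
by rewrite ge0_integralD//; apply/measurable_EFinP; exact: measurable_funTS.
Qed.

Lemma ge0_le_integral_real (D : set R) (g h : R -> R) : measurable D ->
  measurable_fun [set: R] g -> measurable_fun [set: R] h ->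
  (forall x, D x -> (0 <= g x)%R) -> (forall x, D x -> (g x <= h x)%R) ->
  \int[mu]_(x in D) (g x)%:E <= \int[mu]_(x in D) (h x)%:E.
Proof.
move=> mD mg mh g0 gh.
by apply: ge0_le_integral => //; apply/measurable_EFinP; exact: measurable_funTS.
Qed.

Lemma measurable_expRN_div (rho : R) :
  measurable_fun [set: R] (fun u : R => expR (- u / rho)).
Proof.
apply: measurableT_comp; first exact: measurable_expR.
by apply: measurable_funM => //; exact: oppr_measurable.
Qed.

End integral_EFin.

(** * Affine changes of variable on the line *)

Section affine.
Context {R : realType}.
Local Notation mu := (@lebesgue_measure R).

Lemma measurable_affine (a b : R) : measurable_fun [set: R] (fun x => a * x + b : R).
Proof. by apply: measurable_funD => //; exact: measurable_funM. Qed.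

(** Lebesgue measure is determined by its values on intervals, and the preimage of an interval under
    [x -> a x + b] is shorter by the factor [a]. *)
Lemma lebesgue_measure_affine (a b : R) (A : set R) : 0 < a -> measurable A ->
  mu A = (a%:E * pushforward mu
    (fun x : measurableTypeR R => (a * x + b)%R : measurableTypeR R) A)%E.
Proof.
move=> a0 mA.
apply: (@lebesgue_measure_unique R (mscale (NngNum (ltW a0)) (pushforward mu
    (fun x : measurableTypeR R => (a * x + b)%R : measurableTypeR R)))) => //=.
  exact: measurable_affine.
move=> mphi _ [[c d]] _ <-.
rewrite /mscale/= /pushforward.
rewrite (_ : _ @^-1` _ = `](c - b) / a, (d - b) / a]%classic); last first.
  apply/seteqP; split => x /=; rewrite !in_itv/= ltr_pdivrMr// ler_pdivlMr//;
    rewrite [x * a]mulrC; lra.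
rewrite !lebesgue_measure_itv/= !lte_fin.
have -> : ((c - b) / a < (d - b) / a) = (c < d).
  by rewrite ltr_pM2r ?invr_gt0// ltrD2r.
case: ifP => cd; last by rewrite mule0.
by rewrite -EFinB -EFinM; congr EFin; field; rewrite gt_eqF.
Qed.

Lemma ge0_integral_affine (a b : R) (g : R -> \bar R) : 0 < a ->
  measurable_fun [set: R] g -> (forall x, 0 <= g x)%E ->
  (\int[mu]_x g x = a%:E * \int[mu]_x g (a * x + b)%R)%E.
Proof.
move=> a0 mg g0.
rewrite (eq_measure_integral (mscale (NngNum (ltW a0)) (pushforward mu
    (fun x : measurableTypeR R => (a * x + b)%R : measurableTypeR R)))) => /=.
- exact: measurable_affine.
- by move=> mphi; rewrite ge0_integral_mscale//= ge0_integral_pushforward.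
- by move=> mphi A mA _; rewrite (lebesgue_measure_affine a b).
Qed.

Lemma ge0_integral_oppr (g : R -> \bar R) :
  measurable_fun [set: R] g -> (forall x, 0 <= g x)%E ->
  (\int[mu]_x g x = \int[mu]_x g (- x)%R)%E.
Proof.
move=> mg g0.
rewrite (eq_measure_integral (pushforward mu
    (-%R : measurableTypeR R -> measurableTypeR R))) => /=.
  by rewrite ge0_integral_pushforward.
by move=> A mA _; rewrite lebesgue_measureN.
Qed.

End affine.

(** * From expectations to integrals against the density *)

Section density.
Context {d : measure_display} {T : measurableType d} {R : realType}.
Variables (P : probability T R) (X : {RV P >-> R}) (f : R -> R).
Hypotheses (hf : is_pdf f) (hX : has_pdf X f).
Local Notation mu := (@lebesgue_measure R).

Let f0 x : 0 <= f x. Proof. by have [_ + _] := hf; exact. Qed.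
Let mf : measurable_fun [set: R] f. Proof. by have [] := hf. Qed.

(** The law of [X] is absolutely continuous, and its Radon-Nikodym derivative agrees with [f] almost
    everywhere because both have the same integral over every measurable set. *)
Lemma ge0_expectation_pdf (phi : R -> R) :
  measurable_fun [set: R] phi -> (forall x, 0 <= phi x) ->
  (\int[P]_t (phi (X t))%:E = \int[mu]_x (f x * phi x)%:E)%E.
Proof.
move=> mphi phi0.
(* [X] is repackaged with codomain [measurableTypeR R], so that its law and [mu] live on the same
   measurable type. *)
have mX : measurable_fun [set: T] (X : T -> measurableTypeR R).
  by move=> _ Y mY; exact: (measurable_funPT X).
pose X' : {mfun T >-> measurableTypeR R} := HB.pack (X : T -> measurableTypeR R)
  (isMeasurableFun.Build _ _ _ _ _ mX).
pose nu : {finite_measure set (measurableTypeR R) -> \bar R} := distribution P X'.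
have nuE A : measurable A -> nu A = (\int[mu]_(x in A) (f x)%:E)%E by exact: hX.
have numu : nu `<< mu.
  apply/null_content_dominatesP => A mA A0; rewrite nuE//.
  rewrite (ge0_negligible_integral mA mA)// ?setDv ?integral_set0//.
    by apply/measurable_EFinP; exact: measurable_funTS.
  by move=> x _; rewrite lee_fin.
have mphiE : measurable_fun [set: measurableTypeR R] (EFin \o phi).
  exact/measurable_EFinP.
have phiE0 y : (0 <= (EFin \o phi) y)%E by rewrite lee_fin.
rewrite -[LHS](@ge0_integral_distribution _ _ _ _ _ _ X' (EFin \o phi))//.
rewrite -[LHS](Radon_Nikodym_SigmaFinite.change_of_variables numu)//.
have intg := Radon_Nikodym_SigmaFinite.f_integrable numu.
apply: ae_eq_integral => //.
- apply: emeasurable_funM; first exact/measurable_EFinP.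
  exact: measurable_int intg.
- by apply/measurable_EFinP; exact: measurable_funM.
- have : ae_eq mu setT (Radon_Nikodym_SigmaFinite.f nu mu) (EFin \o f).
    apply: integral_ae_eq => //; first exact/measurable_EFinP.
    by move=> E _ mE; rewrite -Radon_Nikodym_SigmaFinite.f_integral// nuE.
  apply: filterS => x /[apply] /= ->.
  by rewrite -EFinM mulrC.
Qed.

End density.

(** * Gamma integrals *)

Section gamma.
Context {R : realType}.
Local Notation mu := (@lebesgue_measure R).

Lemma continuous_powR_gt0 (a x : R) : 0 < x -> {for x, continuous (fun y => y `^ a)}.
Proof.
move=> x0; apply: differentiable_continuous; apply/derivable1_diffP.
by apply: derivable_powR; rewrite in_itv/= x0.
Qed.

(** This is [u <= e^u] at [u = t / (2 a)], raised to the power [a]. It leaves a factor [e^(-t/2)] to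
    dominate the integrand of Gamma. *)
Lemma powR_le_expR (a t : R) : 0 < a -> 0 <= t ->
  t `^ a <= (2 * a) `^ a * expR (t / 2).
Proof.
move=> a0 t0; have a20 : 0 < 2 * a by lra.
have {1}-> : t = 2 * a * (t / (2 * a)) by field; rewrite gt_eqF.
have u0 : 0 <= t / (2 * a) by rewrite divr_ge0// ltW.
rewrite [X in X <= _]powRM ?(ltW a20)// ler_pM2l ?powR_gt0//.
have -> : t / 2 = t / (2 * a) * a by field; rewrite gt_eqF.
rewrite expRM ge0_ler_powR ?nnegrE ?expR_ge0// ?(ltW a0)//.
by have := expR_ge1Dx (t / (2 * a)); lra.
Qed.

Lemma integral_expRN_div (rho : R) : 0 < rho ->
  (\int[mu]_(u in `]0%R, +oo[) (expR (- u / rho))%:E = rho%:E)%E.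
Proof.
move=> rho0; have rV0 : 0 < rho^-1 by rewrite invr_gt0.
have mE D : measurable_fun D (fun u : R => (expR (- u / rho))%:E).
  apply: measurable_funTS; apply/measurable_EFinP.
  apply: measurableT_comp; first exact: measurable_expR.
  by apply: measurable_funM => //; exact: oppr_measurable.
have : (\int[mu]_(x in `[0%R, +oo[) (rho^-1 * expR (- rho^-1 * x))%:E = 1)%E.
  rewrite integral_mkcond -(integral_exponential_pdf rV0).
  by apply: eq_integral => x _; rewrite /exponential_pdf !patchE; case: ifP.
rewrite -integral_itv_obnd_cbnd; last first.
  apply/measurable_EFinP; apply: measurable_funM => //; apply: measurable_funTS.
  apply: measurableT_comp; first exact: measurable_expR.
  exact: measurable_funM.
under eq_integral.
  move=> x _; rewrite /= (_ : - rho^-1 * x = - x / rho) ?EFinM; last by ring.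
  over.
rewrite ge0_integralZl//; [|exact: mE|by rewrite lee_fin ltW].
move=> /(congr1 (fun z => rho%:E * z)%E).
by rewrite mule1 muleA -EFinM divff ?gt_eqF// mul1e.
Qed.

(** [Gamma] is the real part of an extended integral, so the content here is convergence. *)
Lemma GammaE (a : R) : 0 < a ->
  (\int[mu]_(t in `]0%R, +oo[) (t `^ a * expR (- t))%:E = (Gamma (a + 1))%:E)%E.
Proof.
move=> a0; rewrite /Gamma /Rintegral addrK fineK//.
rewrite ge0_fin_numE; last first.
  by apply: integral_ge0 => x _; rewrite lee_fin mulr_ge0 ?powR_ge0 ?expR_ge0.
have mE D : measurable_fun D (fun u : R => expR (- u / 2)).
  apply: measurable_funTS.
  apply: measurableT_comp; first exact: measurable_expR.
  by apply: measurable_funM => //; exact: oppr_measurable.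
apply: (@le_lt_trans _ _ (\int[mu]_(t in `]0%R, +oo[)
    (((2 * a) `^ a)%:E * (expR (- t / 2))%:E))%E).
  apply: ge0_le_integral => //.
  - by move=> x _; rewrite lee_fin mulr_ge0 ?powR_ge0 ?expR_ge0.
  - apply/measurable_EFinP/measurable_funM.
      by apply: measurable_funTS; exact: measurable_powR.
    apply: measurable_funTS; apply: measurableT_comp; first exact: measurable_expR.
    exact: oppr_measurable.
  - by apply/measurable_EFinP; apply: measurable_funM => //; exact: mE.
  - move=> t /=; rewrite in_itv/= andbT => t0; rewrite -EFinM lee_fin.
    have -> : expR (- t / 2) = expR (t / 2) * expR (- t).
      by rewrite -expRD; congr expR; lra.
    rewrite mulrA; apply: ler_wpM2r; first exact: expR_ge0.
    by apply: powR_le_expR => //; exact: ltW.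
rewrite ge0_integralZl//; [|apply/measurable_EFinP; exact: mE|by rewrite lee_fin powR_ge0].
by rewrite integral_expRN_div// -EFinM ltry.
Qed.

Lemma Gamma_ge0 (s : R) : 0 <= Gamma s.
Proof.
by apply: Rintegral_ge0 => x _; rewrite mulr_ge0 ?powR_ge0 ?expR_ge0.
Qed.

Lemma ge0_integral_scale (a : R) (g : R -> \bar R) : 0 < a ->
  measurable_fun [set: R] g -> (forall x, 0 <= g x)%E ->
  (\int[mu]_(x in `]0%R, +oo[) g x = a%:E * \int[mu]_(x in `]0%R, +oo[) g (a * x)%R)%E.
Proof.
move=> a0 mg g0; rewrite integral_mkcond (ge0_integral_affine a 0)//; last 2 first.
- by apply/(measurable_restrictT g) => //; exact: measurable_funTS.
- by move=> x; apply: erestrict_ge0.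
congr (_ * _)%E; rewrite [RHS]integral_mkcond; apply: eq_integral => x _.
by rewrite !patchE addr0 !mem_setE !in_itv/= pmulr_rgt0.
Qed.

Lemma integral_powR_expRN (a rho : R) : 0 < a -> 0 < rho ->
  (\int[mu]_(u in `]0%R, +oo[) (u `^ a * expR (- u / rho))%:E =
   (Gamma (a + 1) * rho `^ (a + 1))%:E)%E.
Proof.
move=> a0 rho0.
have m1 : measurable_fun [set: R] (fun u : R => u `^ a * expR (- u)).
  apply: measurable_funM; first exact: measurable_powR.
  apply: measurableT_comp; first exact: measurable_expR.
  exact: oppr_measurable.
have m2 : measurable_fun [set: R] (fun u : R => u `^ a * expR (- u / rho)).
  apply: measurable_funM; first exact: measurable_powR.
  apply: measurableT_comp; first exact: measurable_expR.
  by apply: measurable_funM => //; exact: oppr_measurable.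
rewrite (ge0_integral_scale _ _ rho0); last 2 first.
- exact/measurable_EFinP.
- by move=> x; rewrite lee_fin mulr_ge0 ?powR_ge0 ?expR_ge0.
under eq_integral => u.
  rewrite inE/= in_itv/= andbT => u0.
  rewrite powRM ?ltW// (_ : - (rho * u) / rho = - u); last by field; rewrite gt_eqF.
  rewrite -mulrA EFinM.
  over.
rewrite ge0_integralZl//; last 3 first.
- by apply/measurable_EFinP; exact: measurable_funTS.
- by move=> x _; rewrite lee_fin mulr_ge0 ?powR_ge0 ?expR_ge0.
- by rewrite lee_fin powR_ge0.
rewrite GammaE// -!EFinM powRD; last by rewrite (gt_eqF rho0) implybT.
by rewrite powRr1 ?(ltW rho0)//; congr EFin; ring.
Qed.

Lemma cvg_powRy (e : R) : 0 < e -> x `^ e @[x --> +oo] --> +oo.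
Proof.
move=> e0; apply/cvgryPge => A; near=> x.
have xA : (`|A| + 1) `^ e^-1 <= x by near: x; apply: nbhs_pinfty_ge; rewrite num_real.
apply: (@le_trans _ _ (((`|A| + 1) `^ e^-1) `^ e)).
  rewrite -powRrM mulVf ?gt_eqF// powRr1 ?addr_ge0//.
  by rewrite (le_trans (ler_norm _))// lerDl.
by apply: ge0_ler_powR; rewrite ?nnegrE ?powR_ge0 ?(ltW e0)// (le_trans (powR_ge0 _ _) xA).
Unshelve. all: by end_near. Qed.

Lemma is_cvg_powRN (b : R) : 0 <= b -> cvg (x `^ (- b) @[x --> +oo]).
Proof.
rewrite le_eqVlt => /predU1P[<-|b0].
  rewrite oppr0 (_ : (fun x : R => x `^ 0) = cst 1); first exact: is_cvg_cst.
  by apply/funext => x; rewrite powRr0.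
apply: (@cvgP _ _ (0 : R)).
under eq_fun do rewrite powRN.
apply: (gtr0_cvgV0 (f := fun x : R => x `^ b) _).2; last exact: cvg_powRy.
by near=> x; rewrite powR_gt0//; near: x; exact: nbhs_pinfty_gt.
Unshelve. all: by end_near. Qed.

(** Substitute [u = t^(1/a)]. For [a > 1] the derivative of this map blows up at 0, so the
    substitution is made on [[c, +oo[] and [c] then decreases to 0. *)
Lemma integral_expRN_powR (a : R) : 1 <= a ->
  (\int[mu]_(u in `]0%R, +oo[) (expR (- (u `^ a)))%:E = (Gamma a^-1 / a)%:E)%E.
Proof.
move=> a1; have a0 : 0 < a by lra.
have aV0 : 0 < a^-1 by rewrite invr_gt0.
have aV1 : a^-1 <= 1 by rewrite invf_le1.
pose F (t : R) := t `^ a^-1.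
pose G (u : R) := expR (- (u `^ a)).
have mG : measurable_fun [set: R] G.
  apply: measurableT_comp; first exact: measurable_expR.
  apply: measurableT_comp; first exact: oppr_measurable.
  exact: measurable_powR.
pose h (t : R) := t `^ (a^-1 - 1) * expR (- t).
have mh : measurable_fun [set: R] h.
  apply: measurable_funM; first exact: measurable_powR.
  apply: measurableT_comp; first exact: measurable_expR.
  exact: oppr_measurable.
have h0 t : 0 <= h t by rewrite mulr_ge0 ?powR_ge0 ?expR_ge0.
have G0 t : 0 <= G t by rewrite expR_ge0.
have F0 (t : R) : 0 < t -> 0 < F t by move=> t0; rewrite powR_gt0.
have dF (t : R) : 0 < t -> F^`()%classic t = a^-1 * t `^ (a^-1 - 1).
  by move=> t0; rewrite powR_derive1// in_itv/= t0.
have cF' (t : R) : 0 < t -> F^`()%classic x @[x --> t] --> F^`()%classic t.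
  move=> t0; rewrite (dF t t0).
  apply: (@cvg_trans _ ((a^-1 * x `^ (a^-1 - 1)) @[x --> t])).
    apply: near_eq_cvg; near=> x; rewrite dF//.
    by near: x; exact: lt_nbhsr.
  have H : x `^ (a^-1 - 1) @[x --> t] --> t `^ (a^-1 - 1) by exact: continuous_powR_gt0.
  exact: (@cvgMl_tmp _ _ _ (nbhs_filter t) _ a^-1 _ H).
have cG (t : R) : 0 < t -> {for t, continuous G}.
  move=> t0; apply: (@continuous_comp _ _ _ (fun u : R => - (u `^ a)) expR).
    by apply: continuousN; exact: continuous_powR_gt0.
  exact: continuous_expR.
have F'y : cvg (F^`()%classic x @[x --> +oo]).
  have /cvg_ex[l hl] : cvg (x `^ (a^-1 - 1) @[x --> +oo]).
    by rewrite -opprB; apply: is_cvg_powRN; rewrite subr_ge0.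
  apply: (@cvgP _ _ (a^-1 * l)).
  apply: (@cvg_trans _ ((a^-1 * x `^ (a^-1 - 1)) @[x --> +oo])).
    by apply: near_eq_cvg; exists 0; split; rewrite ?num_real// => x x0; rewrite dF.
  exact: (@cvgMl_tmp _ _ _ _ _ a^-1 _ hl).
have sub (c : R) : 0 < c ->
  (\int[mu]_(u in `[F c, +oo[) (G u)%:E = a^-1%:E * \int[mu]_(t in `[c, +oo[) (h t)%:E)%E.
  move=> c0.
  rewrite (@increasing_ge0_integration_by_substitutiony R F G c).
  - rewrite -ge0_integralZl//.
    + apply: eq_integral => t; rewrite inE/= in_itv/= andbT => ct.
      have t0 : 0 < t by rewrite (lt_le_trans c0).
      rewrite -EFinM; congr EFin.
      transitivity (G (F t) * F^`()%classic t); first by [].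
      rewrite dF// /G /F /h -powRrM mulVf ?gt_eqF// powRr1 ?(ltW t0)//.
      by ring.
    + by apply/measurable_EFinP; exact: measurable_funTS.
    + by move=> x _; rewrite lee_fin.
    + by rewrite lee_fin ltW.
  - move=> x y; rewrite !in_itv/= !andbT => cx cy xy.
    by apply: gt0_ltr_powR => //; rewrite nnegrE; lra.
  - by move=> x; rewrite in_itv/= andbT => cx; apply: cF'; lra.
  - apply/cvg_ex; exists (F^`()%classic c).
    by apply: cvg_at_right_filter; exact: cF'.
  - exact: F'y.
  - split.
      move=> x; rewrite in_itv/= andbT => cx; apply: derivable_powR.
      by rewrite in_itv/= andbT; lra.
    by apply: cvg_at_right_filter; exact: continuous_powR_gt0.
  - exact: cvg_powRy.
  - apply/continuous_within_itvcyP; split.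
      move=> x; rewrite in_itv/= andbT => cx; apply: cG.
      by rewrite (lt_trans (F0 _ c0)).
    by apply: cvg_at_right_filter; apply: cG; exact: F0.
  - by move=> x _.
(* Cut-offs decreasing to 0: both families of half-lines exhaust []0, +oo[], and monotone
   convergence applies on each side. *)
pose c_ (n : nat) : R := n.+1%:R^-1.
have c_gt0 n : 0 < c_ n by rewrite invr_gt0.
have c_small (x : R) : 0 < x -> exists n, c_ n <= x.
  move=> x0; exists (Num.truncn x^-1); rewrite /c_ invf_ple ?posrE//.
  by apply: ltW; rewrite truncnS_gt.
have c_dec n m : (n <= m)%N -> c_ m <= c_ n.
  by move=> nm; rewrite /c_ lef_pV2 ?posrE// ler_nat ltnS.
have cvgG : (\int[mu]_(u in `[F (c_ n), +oo[) (G u)%:E @[n --> \oo] -->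
    \int[mu]_(u in `]0%R, +oo[) (G u)%:E)%E.
  rewrite (_ : `]0, +oo[%classic = \bigcup_n `[F (c_ n), +oo[%classic); last first.
    apply/seteqP; split => x /=.
      rewrite in_itv/= andbT => x0; have [n hn] := c_small (x `^ a) (powR_gt0 _ x0).
      exists n => //=; rewrite in_itv/= andbT.
      rewrite -[x](powRr1 (ltW x0)) -(@mulfV _ a) ?gt_eqF// powRrM.
      by apply: ge0_ler_powR; rewrite ?nnegrE ?powR_ge0// ltW.
    by move=> [n _]/=; rewrite !in_itv/= !andbT; apply: lt_le_trans; exact: F0.
  apply: ge0_nondecreasing_set_cvg_integral => //.
  - move=> n m nm; rewrite subsetEset => x /=; rewrite !in_itv/= !andbT.
    apply: le_trans; apply: ge0_ler_powR; rewrite ?nnegrE ?(ltW (c_gt0 _)) ?(ltW aV0)//.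
    exact: c_dec.
  - by move=> n; apply/measurable_EFinP; exact: measurable_funTS.
  - by move=> n x _; rewrite lee_fin.
have cvgh : (a^-1%:E * \int[mu]_(u in `[c_ n, +oo[) (h u)%:E @[n --> \oo] -->
    a^-1%:E * \int[mu]_(u in `]0%R, +oo[) (h u)%:E)%E.
  apply: cvgeZl => //.
  rewrite (_ : `]0, +oo[%classic = \bigcup_n `[c_ n, +oo[%classic); last first.
    apply/seteqP; split => x /=.
      rewrite in_itv/= andbT => x0; have [n hn] := c_small x x0.
      by exists n => //=; rewrite in_itv/= andbT.
    by move=> [n _]/=; rewrite !in_itv/= !andbT; apply: lt_le_trans.
  apply: ge0_nondecreasing_set_cvg_integral => //.
  - move=> n m nm; rewrite subsetEset => x /=; rewrite !in_itv/= !andbT.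
    by apply: le_trans; exact: c_dec.
  - by move=> n; apply/measurable_EFinP; exact: measurable_funTS.
  - by move=> n x _; rewrite lee_fin.
have eqI : (\int[mu]_(u in `]0%R, +oo[) (G u)%:E =
    a^-1%:E * \int[mu]_(u in `]0%R, +oo[) (h u)%:E)%E.
  move: cvgG; rewrite (_ : (fun n => _) = fun n =>
    a^-1%:E * \int[mu]_(u in `[c_ n, +oo[) (h u)%:E)%E; last first.
    by apply/funext => n; rewrite sub.
  by move=> cvgG; exact: cvg_unique cvgG cvgh.
have mexp : measurable_fun [set: R] (fun u : R => expR (- u)).
  apply: measurableT_comp; first exact: measurable_expR.
  exact: oppr_measurable.
(* The exponent in [h] is at most 0, outside the range of [GammaE]. Finiteness of its integral is
   instead read back through [eqI] from that of [G], using [u^a >= u - 1]. *)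
have Gfin : (\int[mu]_(u in `]0%R, +oo[) (G u)%:E < +oo)%E.
  apply: (@le_lt_trans _ _
      (\int[mu]_(u in `]0%R, +oo[) (expR 1 * expR (- u))%:E)%E).
    apply: ge0_le_integral_real => //; first exact: measurable_funM.
    - move=> u /=; rewrite in_itv/= andbT => u0.
      rewrite -expRD ler_expR.
      have [u1|u1] := leP 1 u; first by have := le1r_powR u1 a1; lra.
      by have := powR_ge0 u a; lra.
  rewrite ge0_integralZl_real ?expR_ge0//.
  under eq_integral do rewrite -[X in expR X]divr1.
  by rewrite integral_expRN_div// -EFinM ltry.
have hfin : (\int[mu]_(u in `]0%R, +oo[) (h u)%:E)%E \is a fin_num.
  have hI0 : (0 <= \int[mu]_(u in `]0%R, +oo[) (h u)%:E)%E.
    by apply: integral_ge0 => x _; rewrite lee_fin.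
  rewrite ge0_fin_numE// ltNge leye_eq; apply/negP => /eqP hy.
  by move: Gfin; rewrite eqI hy gt0_muley ?lte_fin// ltxx.
by rewrite eqI /Gamma /Rintegral mulrC EFinM fineK.
Unshelve. all: by end_near. Qed.

(** The primitive of [t^2 e^(-t)] is [-(t^2 + 2 t + 2) e^(-t)], equal to [-2] at 0 and vanishing at
    infinity. *)
Lemma Gamma3_le2 : Gamma 3 <= 2 :> R.
Proof.
pose p : {poly R} := - ('X^2 + 2 *: 'X + 2%:P).
pose F : R -> R := horner p * (expR \o -%R).
pose f : R -> R := fun t => t ^+ 2 * expR (- t).
have FE t : F t = - ((t ^+ 2 + 2 * t + 2) * expR (- t)).
  by rewrite /F fctE/= /p !hornerE; ring.
have dF (t : R) : is_derive t 1 F (f t).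
  have := is_deriveM (is_derive_poly p t)
    (is_derive1_comp (is_derive_expR (- t)) (is_deriveNid t (1 : R))).
  move=> H; apply: (is_derive_eq H).
  rewrite /f /p derivN !derivD derivXn derivZ derivX derivC.
  rewrite !hornerE /GRing.scale/=.
  by ring.
have cF : continuous F.
  by move=> t; apply: differentiable_continuous; apply/derivable1_diffP.
have cf : continuous f.
  move=> t; apply: (@continuousM R R (fun t => t ^+ 2) (fun t => expR (- t))).
    exact: exprn_continuous.
  by apply: continuous_comp; [exact: opp_continuous|exact: continuous_expR].
have Fy : F x @[x --> +oo] --> 0.
  apply/cvgrPdist_le => e e0.
  (* The primitive is bounded by [16 e^(-x/2)], which is at most [32 / x] since
     [x / 2 <= e^(x/2)]. *)
  exists (32 / e); split; rewrite ?num_real// => x xe.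
  have x0 : 0 < x by rewrite (lt_trans _ xe)// divr_gt0.
  rewrite sub0r normrN FE normrN ger0_norm ?mulr_ge0 ?expR_ge0//; last first.
    by have := sqr_ge0 x; lra.
  have h1 : x ^+ 2 + 2 * x + 2 <= 16 * expR (x / 2).
    have := expR_ge1Dxn 1 (ltW (divr_gt0 x0 (ltr0Sn R 1))).
    rewrite !expr2 (_ : 2`! = 2%N)//; nra.
  have h2 : expR (- x) = expR (x / 2) * expR (- (x / 2)) ^+ 3.
    by rewrite -expRM_natl -expRD; congr expR; lra.
  have h3 : expR (x / 2) * expR (- (x / 2)) = 1 by exact: expRxMexpNx_1.
  apply: (@le_trans _ _ (16 * expR (- (x / 2)))).
    apply: (@le_trans _ _ (16 * expR (x / 2) * expR (- x))).
      by rewrite ler_wpM2r ?expR_ge0.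
    rewrite h2 (_ : 16 * _ * _ =
      16 * (expR (x / 2) * expR (- (x / 2))) ^+ 2 * expR (- (x / 2))); last by ring.
    by rewrite h3 expr1n mulr1.
  have h4 : x / 2 <= expR (x / 2) by have := expR_ge1Dx (x / 2); lra.
  rewrite expRN ler_pdivrMr ?expR_gt0//.
  by move: xe; rewrite ltr_pdivrMr// => xe; nra.
have -> : 3 = 2 + 1 :> R by lra.
rewrite -lee_fin -GammaE//.
under eq_integral => t.
  rewrite inE/= in_itv/= andbT => t0; rewrite powR_mulrn ?(ltW t0)//.
  over.
have mf : measurable_fun [set: R] f by exact: continuous_measurable_fun.
rewrite integral_itv_obnd_cbnd; last first.
  by apply/measurable_EFinP; exact: measurable_funTS.
rewrite (@ge0_continuous_FTC2y _ f F 0 0)//.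
- by rewrite FE oppr0 expR0 -EFinB lee_fin; lra.
- by move=> x x0; rewrite mulr_ge0 ?expR_ge0 ?sqr_ge0.
- exact: continuous_subspaceT.
- by apply: cvg_at_right_filter; exact: cF.
- by move=> x _; rewrite derive1E derive_val.
Qed.

End gamma.

(** * Tail moments of log-concave functions *)

Section log_concave.
Context {R : realType}.
Local Notation mu := (@lebesgue_measure R).

(** The points [x] and [m + s] are the convex combinations of [m] and [x + s] with exchanged
    weights; multiplying the two log-concavity inequalities gives the claim. In other words,
    [f(y + s) / f(y)] does not increase with [y]. *)
Lemma log_concave_cross (f : R -> R) (m x s : R) : (forall y, 0 <= f y) ->
  log_concave f -> m <= x -> 0 <= s -> f (x + s) * f m <= f x * f (m + s).
Proof.
move=> f0 lc mx s0.
have [e|e0] := eqVneq (x - m + s) 0.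
  have -> : x = m by lra.
  have -> : s = 0 by lra.
  by rewrite !addr0.
have e1 : 0 < x - m + s by rewrite lt_neqAle eq_sym e0; lra.
pose th := s / (x - m + s).
have th01 : 0 <= th <= 1.
  apply/andP; split; first by rewrite divr_ge0// ltW.
  by rewrite ler_pdivrMr// mul1r; lra.
have h1 := lc m (x + s) th th01.
have h2 := lc (x + s) m th th01.
have e2 : th * m + (1 - th) * (x + s) = x by rewrite /th; field.
have e3 : th * (x + s) + (1 - th) * m = m + s by rewrite /th; field.
rewrite e2 in h1; rewrite e3 in h2.
have pw (a : R) : 0 <= a -> a = a `^ th * a `^ (1 - th).
  by move=> a0; rewrite -powRD ?subrKC ?powRr1// oner_eq0.
have := ler_pM (mulr_ge0 (powR_ge0 _ _) (powR_ge0 _ _))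
  (mulr_ge0 (powR_ge0 _ _) (powR_ge0 _ _)) h1 h2.
apply: le_trans; rewrite {1}(pw (f (x + s)))// {1}(pw (f m))//.
by rewrite le_eqVlt; apply/orP; left; apply/eqP; ring.
Qed.

(* [phi] crosses [g y = k exp(-y / rho)] once, downwards, at some [c], so that
   [(y^a - c^a) (phi y - g y) <= 0] for all [y > 0]. Strictness of the mass
   hypothesis is what forces the crossing to happen. *)
Lemma log_concave_moment (a : R) (phi : R -> R) (k rho : R) : 0 < a ->
  (forall y, 0 <= phi y) -> log_concave phi -> measurable_fun [set: R] phi ->
  0 < k <= phi 0 -> 0 < rho ->
  (\int[mu]_(u in `]0%R, +oo[) (phi u)%:E < (k * rho)%:E)%E ->
  (\int[mu]_(u in `]0%R, +oo[) (u `^ a * phi u)%:E <=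
    (Gamma (a + 1) * rho `^ a * (k * rho))%:E)%E.
Proof.
move=> a0 phi0 lc mphi /andP[k0 kphi] rho0 intphi.
pose g (y : R) := k * expR (- y / rho).
have g0 y : 0 <= g y by rewrite mulr_ge0 ?expR_ge0// ltW.
have mexp := measurable_expRN_div rho.
have mg : measurable_fun [set: R] g by exact: measurable_funM.
have intg : (\int[mu]_(u in `]0%R, +oo[) (g u)%:E = (k * rho)%:E)%E.
  rewrite ge0_integralZl_real ?(ltW k0)//.
  by rewrite integral_expRN_div.
(* [g] is log-affine and [phi] log-concave, so lying above [g] at 0 and at [e] propagates to every
   point in between. *)
have cross y e : 0 <= y -> y < e -> g e <= phi e -> g y <= phi y.
  move=> y0 ye ge.
  have e0 : 0 < e by lra.
  pose th := 1 - y / e.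
  have th01 : 0 <= th <= 1.
    have : 0 <= y / e by rewrite divr_ge0// ltW.
    have : y / e <= 1 by rewrite ler_pdivrMr// mul1r ltW.
    by rewrite /th; lra.
  have /andP[th0 th1] := th01.
  have := lc 0 e th th01.
  rewrite (_ : th * 0 + (1 - th) * e = y); last by rewrite /th; field; rewrite gt_eqF.
  apply: le_trans.
  apply: (@le_trans _ _ (k `^ th * (g e) `^ (1 - th))).
    rewrite /g powRM ?expR_ge0 ?(ltW k0)// mulrA -powRD; last first.
      by rewrite subrKC oner_eq0.
    rewrite subrKC powRr1 ?(ltW k0)// -expRM ler_pM2l// ler_expR.
    rewrite le_eqVlt; apply/orP; left; apply/eqP; rewrite /th; field.
    by rewrite !gt_eqF.
  apply: ler_pM; rewrite ?powR_ge0//.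
    by apply: ge0_ler_powR; rewrite ?nnegrE// ltW.
  by apply: ge0_ler_powR; rewrite ?nnegrE// subr_ge0.
have [y0 y00 gy0] : exists2 y0, 0 < y0 & phi y0 < g y0.
  apply: contrapT => H; move: intphi; apply/negP; rewrite -leNgt -intg.
  apply: ge0_le_integral_real => //.
  move=> x /=; rewrite in_itv/= andbT => x0.
  by rewrite leNgt; apply/negP => xg; apply: H; exists x.
pose E := [set y : R | 0 <= y /\ g y <= phi y].
have E0 : E 0 by split => //; rewrite /g oppr0 mul0r expR0 mulr1.
(* By [cross], a point of [E] beyond [y0] would put [phi] above [g] at [y0] too; hence the crossing
   point [sup E] is finite. *)
have ubE : ubound E y0.
  move=> y [yy0 gy]; rewrite leNgt; apply/negP => y0y.
  by have := cross y0 y (ltW y00) y0y gy; rewrite leNgt gy0.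
have supE : has_sup E by split; [exists 0|exists y0].
pose c := sup E.
have c0 : 0 <= c by apply: ub_le_sup E0; exists y0.
(* The inequality [(y^a - c^a) (phi y - g y) <= 0], rearranged so that only nonnegative functions
   are integrated. *)
have point y : 0 < y -> y `^ a * phi y + c `^ a * g y <= y `^ a * g y + c `^ a * phi y.
  move=> yy0.
  have [yc|cy|->] := ltgtP y c; last by lra.
    have cy : 0 < c - y by rewrite subr_gt0.
    have [e Ee ye] := sup_adherent cy supE.
    rewrite subKr in ye.
    have ya : y `^ a <= c `^ a by apply: ge0_ler_powR; rewrite ?nnegrE// ltW.
    have := cross y e (ltW yy0) ye Ee.2; nra.
  have gy : phi y < g y.
    rewrite ltNge; apply/negP => gy; move: cy; apply/negP; rewrite -leNgt.
    by apply: ub_le_sup; [exists y0|split => //; exact: ltW].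
  have : c `^ a <= y `^ a by apply: ge0_ler_powR; rewrite ?nnegrE// ltW.
  by nra.
have ca0 : 0 <= c `^ a by rewrite powR_ge0.
have mpow : measurable_fun [set: R] (fun y : R => y `^ a) by exact: measurable_powR.
have : (\int[mu]_(y in `]0%R, +oo[) (y `^ a * phi y + c `^ a * g y)%:E <=
  \int[mu]_(y in `]0%R, +oo[) (y `^ a * g y + c `^ a * phi y)%:E)%E.
  apply: ge0_le_integral_real => //.
  - by mfun.
  - by mfun.
  - by move=> y _; apply: addr_ge0; apply: mulr_ge0; rewrite ?powR_ge0.
  - by move=> y /=; rewrite in_itv/= andbT; exact: point.
rewrite !ge0_integralD_real//; try (by mfun);
  try (by move=> y _; apply: mulr_ge0; rewrite ?powR_ge0).
rewrite !(ge0_integralZl_real _ (c `^ a))// intg.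
have -> : (\int[mu]_(y in `]0%R, +oo[) (y `^ a * g y)%:E =
    (Gamma (a + 1) * rho `^ a * (k * rho))%:E)%E.
  under eq_integral do rewrite mulrCA.
  rewrite ge0_integralZl_real ?(ltW k0)//.
  - rewrite integral_powR_expRN// -EFinM; congr EFin.
    rewrite powRD ?powRr1 ?(ltW rho0)//; last by rewrite (gt_eqF rho0) implybT.
    by ring.
  - exact: measurable_funM.
  - by move=> x _; rewrite mulr_ge0 ?powR_ge0 ?expR_ge0.
(* The mass of [phi] is less than that of [g], so the terms in [c^a] can be cancelled. *)
move=> H; rewrite -(leeD2rE _ _ (x := ((c `^ a)%:E * (k * rho)%:E)%E))//.
by apply: (le_trans H); rewrite leeD2l// lee_wpmul2l// ltW.
Qed.

Lemma log_concave_shift (f : R -> R) (x : R) :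
  log_concave f -> log_concave (fun u => f (x + u)).
Proof.
move=> lc u v th th01; apply: (le_trans (lc (x + u) (x + v) th th01)).
by rewrite le_eqVlt; apply/orP; left; apply/eqP; congr f; ring.
Qed.

Lemma log_concave_oppr (f : R -> R) :
  log_concave f -> log_concave (fun u => f (- u)).
Proof.
move=> lc u v th th01; apply: (le_trans (lc (- u) (- v) th th01)).
by rewrite le_eqVlt; apply/orP; left; apply/eqP; congr f; ring.
Qed.

(** One scale [rho], chosen at [m], serves every [x >= m]: by [log_concave_cross], the ratio of the
    mass beyond [x] to [f x] is at most the same ratio at [m]. *)
Lemma log_concave_tail_moment (a m x rho : R) (f : R -> R) : 0 < a ->
  (forall y, 0 <= f y) -> log_concave f -> measurable_fun [set: R] f ->
  0 < rho -> m <= x ->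
  (\int[mu]_(u in `]0%R, +oo[) (f (m + u))%:E < (f m * rho)%:E)%E ->
  (\int[mu]_(u in `]0%R, +oo[) (u `^ a * f (x + u))%:E <=
    (Gamma (a + 1) * rho `^ a)%:E * \int[mu]_(u in `]0%R, +oo[) (f (x + u))%:E)%E.
Proof.
move=> a0 f0 lc mf rho0 mx hm.
have mfs y : measurable_fun [set: R] (fun u => f (y + u)).
  by apply: measurableT_comp => //; exact: measurable_funD.
have G0 y : (0 <= \int[mu]_(u in `]0%R, +oo[) (f (y + u))%:E)%E.
  by apply: integral_ge0 => u _; rewrite lee_fin.
have C0 : 0 <= Gamma (a + 1) * rho `^ a by rewrite mulr_ge0 ?Gamma_ge0 ?powR_ge0.
have fm0 : 0 < f m.
  by have := le_lt_trans (G0 m) hm; rewrite lte_fin pmulr_lgt0.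
have mf1 : (\int[mu]_(u in `]0%R, +oo[) (f (m + u))%:E)%E \is a fin_num.
  by rewrite ge0_fin_numE// (lt_trans hm)// ltry.
have GxGm : ((f m)%:E * \int[mu]_(u in `]0%R, +oo[) (f (x + u))%:E <=
    (f x)%:E * \int[mu]_(u in `]0%R, +oo[) (f (m + u))%:E)%E.
  rewrite -!ge0_integralZl_real//.
  apply: ge0_le_integral_real => //; try by mfun.
  - by move=> u _; apply: mulr_ge0.
  - move=> u /=; rewrite in_itv/= andbT => u0.
    by rewrite mulrC; apply: log_concave_cross => //; exact: ltW.
(* Since [f m > 0], a zero of [f] at [x] makes [f] vanish everywhere to the right of [x]. *)
have [fx0|fxN0] := eqVneq (f x) 0.
  rewrite integral0_eq ?mule_ge0 ?lee_fin// => u /=.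
  rewrite in_itv/= andbT => u0; congr EFin.
  have := log_concave_cross f m x u f0 lc mx (ltW u0); rewrite fx0 mul0r.
  by rewrite pmulr_lle0// => fxu; rewrite (le_anti (introT andP (conj fxu (f0 _)))) mulr0.
have fx0 : 0 < f x by rewrite lt_neqAle eq_sym fxN0 f0.
have Gxfin : (\int[mu]_(u in `]0%R, +oo[) (f (x + u))%:E)%E \is a fin_num.
  rewrite ge0_fin_numE// ltNge leye_eq; apply/negP => /eqP Gy.
  by move: GxGm; rewrite Gy gt0_muley ?lte_fin// -(fineK mf1) -EFinM leye_eq.
(* The comparison exponential has height [t / rho], hence mass [t]. Its height must not exceed
   [f x], and [t] must exceed the tail mass strictly; [t] is then lowered to that mass. *)
have key t : (\int[mu]_(u in `]0%R, +oo[) (f (x + u))%:E < t%:E)%E -> t <= f x * rho ->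
  (\int[mu]_(u in `]0%R, +oo[) (u `^ a * f (x + u))%:E <=
   (Gamma (a + 1) * rho `^ a * t)%:E)%E.
  move=> Gt tx; have t0 : 0 < t by have := le_lt_trans (G0 x) Gt; rewrite lte_fin.
  have -> : t = t / rho * rho by rewrite divfK ?gt_eqF.
  apply: log_concave_moment => //.
  - exact: log_concave_shift.
  - by rewrite addr0 divr_gt0//= ler_pdivrMr.
  - by rewrite divfK ?gt_eqF.
move: GxGm key hm; rewrite -(fineK Gxfin) -(fineK mf1).
set g := fine _; set gm := fine _ => GxGm key hm.
have gx : g < f x * rho.
  move: GxGm hm; rewrite -!EFinM lee_fin lte_fin => h1 h2.
  rewrite -(ltr_pM2l fm0); apply: (le_lt_trans h1).
  by rewrite mulrCA ltr_pM2l.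
set C := Gamma (a + 1) * _ in C0 key *.
rewrite -EFinM; apply/lee_addgt0Pr => e e0.
(* [C] is only known to be nonnegative; [C + 1] is a safe denominator. *)
have eC0 : 0 < e / (C + 1) by rewrite divr_gt0// ltr_wpDl.
have eC : C * (e / (C + 1)) <= e.
  by rewrite mulrA ler_pdivrMr ?ltr_wpDl//; nra.
apply: (le_trans (key (Num.min (f x * rho) (g + e / (C + 1))) _ _)).
- by rewrite lte_fin lt_min gx ltrDl.
- by rewrite ge_min lexx.
- rewrite -EFinD lee_fin; apply: (@le_trans _ _ (C * (g + e / (C + 1)))).
    by apply: ler_wpM2l => //; rewrite ge_min lexx orbT.
  by rewrite mulrDr lerD2l.
Qed.

End log_concave.

(** * Double integrals and one-sided powers *)

Section double_integral.
Context {R : realType}.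
Local Notation mu := (@lebesgue_measure R).
Local Notation mu2 := (mu \x mu)%E.

Lemma double_integral_xy (F : R * R -> R) : measurable_fun [set: R * R] F ->
  (forall z, 0 <= F z) ->
  (\int[mu2]_z (F z)%:E = \int[mu]_x \int[mu]_y (F (x, y))%:E)%E.
Proof.
move=> mF F0; rewrite (@fubini_tonelli1 _ _ _ _ _ mu mu (EFin \o F))//.
exact/measurable_EFinP.
Qed.

Lemma double_integral_yx (F : R * R -> R) : measurable_fun [set: R * R] F ->
  (forall z, 0 <= F z) ->
  (\int[mu2]_z (F z)%:E = \int[mu]_y \int[mu]_x (F (x, y))%:E)%E.
Proof.
move=> mF F0; rewrite (@fubini_tonelli2 _ _ _ _ _ mu mu (EFin \o F))//.
exact/measurable_EFinP.
Qed.

Lemma double_integral_swap (F : R * R -> R) : measurable_fun [set: R * R] F ->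
  (forall z, 0 <= F z) ->
  (\int[mu2]_z (F z)%:E = \int[mu2]_z (F (z.2, z.1))%:E)%E.
Proof.
move=> mF F0; rewrite double_integral_xy// double_integral_yx//.
by apply: measurableT_comp => //; exact: measurable_swap.
Qed.

Lemma double_integralD (F G : R * R -> R) : measurable_fun [set: R * R] F ->
  measurable_fun [set: R * R] G ->
  (forall z, 0 <= F z) -> (forall z, 0 <= G z) ->
  (\int[mu2]_z (F z + G z)%:E = \int[mu2]_z (F z)%:E + \int[mu2]_z (G z)%:E)%E.
Proof.
move=> mF mG F0 G0; under eq_integral do rewrite EFinD.
by rewrite ge0_integralD//; first [by move=> z _; rewrite lee_fin | exact/measurable_EFinP].
Qed.

Lemma double_integral_le (F G : R * R -> R) : measurable_fun [set: R * R] F ->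
  measurable_fun [set: R * R] G ->
  (forall z, 0 <= F z) -> (forall z, F z <= G z) ->
  (\int[mu2]_z (F z)%:E <= \int[mu2]_z (G z)%:E)%E.
Proof.
by move=> mF mG F0 FG; apply: ge0_le_integral => //;
  first [by move=> z _; rewrite lee_fin | exact/measurable_EFinP].
Qed.

Lemma measurable_fst_comp (f : R -> R) : measurable_fun [set: R] f ->
  measurable_fun [set: R * R] (fun z => f z.1).
Proof. by move=> mf; apply: measurableT_comp. Qed.

Lemma measurable_snd_comp (f : R -> R) : measurable_fun [set: R] f ->
  measurable_fun [set: R * R] (fun z => f z.2).
Proof. by move=> mf; apply: measurableT_comp. Qed.

Lemma measurable_sub_comp (f : R -> R) : measurable_fun [set: R] f ->
  measurable_fun [set: R * R] (fun z => f (z.2 - z.1)).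
Proof.
by move=> mf; apply: measurableT_comp => //; apply: measurable_funB.
Qed.

Lemma double_integral_prod (f g : R -> R) : measurable_fun [set: R] f ->
  measurable_fun [set: R] g -> (forall x, 0 <= f x) -> (forall x, 0 <= g x) ->
  (\int[mu]_x (g x)%:E < +oo)%E ->
  (\int[mu2]_z (f z.1 * g z.2)%:E = \int[mu]_x (f x)%:E * \int[mu]_x (g x)%:E)%E.
Proof.
move=> mf mg f0 g0 gfin.
have gE : (\int[mu]_x (g x)%:E)%E \is a fin_num.
  by rewrite ge0_fin_numE//; apply: integral_ge0 => x _; rewrite lee_fin.
have mfg : measurable_fun [set: R * R] (fun z => f z.1 * g z.2).
  by apply: measurable_funM; [exact: measurable_fst_comp|exact: measurable_snd_comp].
rewrite double_integral_xy//; last by move=> z; exact: mulr_ge0.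
under eq_integral => x _ do rewrite /= ge0_integralZl_real//.
have c0 : 0 <= fine (\int[mu]_x (g x)%:E)%E.
  by rewrite fine_ge0//; apply: integral_ge0 => x _; rewrite lee_fin.
rewrite -(fineK gE); under eq_integral => x _ do rewrite -EFinM mulrC.
by rewrite ge0_integralZl_real// muleC.
Qed.

(* [powR] takes the junk value [1] at negative arguments, whence the truncation. *)
Definition pospow (a u : R) : R := Num.max u 0 `^ a.

Lemma pospow_ge0 a u : 0 <= pospow a u. Proof. exact: powR_ge0. Qed.

Lemma measurable_pospow a : measurable_fun [set: R] (pospow a).
Proof.
have mmax : measurable_fun [set: R] (fun u : R => Num.max u 0).
  by apply: measurable_maxr => //; exact: measurable_cst.
exact: (measurableT_comp (@measurable_powR R a) mmax).
Qed.

Lemma pospow_gt0 a u : 0 < u -> pospow a u = u `^ a.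
Proof. by move=> u0; rewrite /pospow max_l// ltW. Qed.

Lemma pospow_le0 a u : 0 < a -> u <= 0 -> pospow a u = 0.
Proof. by move=> a0 u0; rewrite /pospow max_r// powR0// gt_eqF. Qed.

Lemma pospow_norm a u : 0 < a -> `|u| `^ a = pospow a u + pospow a (- u).
Proof.
move=> a0; have [u0|u0|->] := ltgtP u 0.
- by rewrite ltr0_norm// (pospow_le0 _ _ a0 (ltW u0)) add0r pospow_gt0// oppr_gt0.
- by rewrite gtr0_norm// pospow_gt0// pospow_le0 ?addr0// oppr_le0 ltW.
- by rewrite normr0 oppr0 pospow_le0// addr0 powR0// gt_eqF.
Qed.

Definition ind_gt0 (u : R) : R := (0 < u)%R%:R.

Lemma ind_gt0_ge0 u : 0 <= ind_gt0 u. Proof. by rewrite /ind_gt0 ler0n. Qed.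

Lemma measurable_ind_gt0 : measurable_fun [set: R] ind_gt0.
Proof.
rewrite (_ : ind_gt0 = \1_(`]0, +oo[%classic : set R)); first exact: measurable_indic.
by apply/funext => u; rewrite indicE mem_setE in_itv/= andbT.
Qed.

Lemma integral_ind_gt0_shift (x : R) (f : R -> R) : (forall y, 0 <= f y) ->
  measurable_fun [set: R] f ->
  (\int[mu]_y (ind_gt0 (y - x) * f y)%:E = \int[mu]_(u in `]0%R, +oo[) (f (x + u))%:E)%E.
Proof.
move=> f0 mf; rewrite (ge0_integral_affine 1 x)//; last 2 first.
- apply/measurable_EFinP; apply: measurable_funM => //.
  apply: (measurableT_comp measurable_ind_gt0).
  by apply: measurable_funB.
- by move=> y; rewrite lee_fin mulr_ge0// ?ind_gt0_ge0.
rewrite mul1e [RHS]integral_mkcond; apply: eq_integral => u _.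
rewrite patchE mem_setE in_itv/= andbT /ind_gt0 mul1r addrK [u + x]addrC.
by case: ifP => _; rewrite ?mul1r ?mul0r.
Qed.

Lemma integral_pospow_shift (a x : R) (f : R -> R) : 0 < a -> (forall y, 0 <= f y) ->
  measurable_fun [set: R] f ->
  (\int[mu]_y (pospow a (y - x) * f y)%:E =
   \int[mu]_(u in `]0%R, +oo[) (u `^ a * f (x + u))%:E)%E.
Proof.
move=> a0 f0 mf; rewrite (ge0_integral_affine 1 x)//; last 2 first.
- apply/measurable_EFinP; apply: measurable_funM => //.
  apply: (measurableT_comp (measurable_pospow a)).
  by apply: measurable_funB.
- by move=> y; rewrite lee_fin mulr_ge0// pospow_ge0.
rewrite mul1e [RHS]integral_mkcond; apply: eq_integral => u _.
rewrite patchE mem_setE in_itv/= andbT mul1r addrK [u + x]addrC.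
case: ifP => u0; first by rewrite pospow_gt0.
by rewrite pospow_le0 ?mul0r// leNgt u0.
Qed.

(** The open half-planes on the two sides of the diagonal are disjoint and exchanged by the swap, so
    each carries at most half of the product mass. *)
Lemma double_integral_half_plane (h : R -> R) : (forall y, 0 <= h y) ->
  measurable_fun [set: R] h -> (\int[mu]_x (h x)%:E < +oo)%E ->
  (2%:E * \int[mu2]_z (ind_gt0 (z.2 - z.1) * (h z.1 * h z.2))%:E <=
   \int[mu]_x (h x)%:E * \int[mu]_x (h x)%:E)%E.
Proof.
move=> h0 mh hfin.
pose F (z : R * R) := ind_gt0 (z.2 - z.1) * (h z.1 * h z.2).
have mhh : measurable_fun [set: R * R] (fun z => h z.1 * h z.2).
  by apply: measurable_funM; [exact: measurable_fst_comp|exact: measurable_snd_comp].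
have mF : measurable_fun [set: R * R] F.
  by apply: measurable_funM => //; exact: measurable_sub_comp measurable_ind_gt0.
have F0 z : 0 <= F z by rewrite !mulr_ge0// ?ind_gt0_ge0.
have mFs : measurable_fun [set: R * R] (fun z => F (z.2, z.1)).
  by apply: measurableT_comp => //; exact: measurable_swap.
rewrite -double_integral_prod// mule_natl mule2n {2}double_integral_swap//.
rewrite -double_integralD//; last by move=> z; exact: (F0 (z.2, z.1)).
apply: double_integral_le => //.
- exact: (measurable_funD mF mFs).
- by move=> z; exact: addr_ge0 (F0 z) (F0 (z.2, z.1)).
- move=> [x y]; rewrite /F/= [h y * h x]mulrC -mulrDl ler_piMl ?mulr_ge0//.
  rewrite /ind_gt0 !subr_gt0; case: ltgtP => //=; rewrite ?addr0 ?add0r//.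
Qed.

End double_integral.

(** * Pairs lying to the right of [m] *)

Section pairwise_moment.
Context {R : realType}.
Local Notation mu := (@lebesgue_measure R).
Local Notation mu2 := (mu \x mu)%E.

(** Closed partner of [ind_gt0]: the identity [ind_gt0 u + ind_ge0 (- u) = 1] gives splittings that
    are exact at every point. *)
Definition ind_ge0 (u : R) : R := (0 <= u)%R%:R.

Lemma ind_ge0_ge0 u : 0 <= ind_ge0 u. Proof. by rewrite /ind_ge0 ler0n. Qed.

Lemma measurable_ind_ge0 : measurable_fun [set: R] ind_ge0.
Proof.
rewrite (_ : ind_ge0 = \1_(`[0, +oo[%classic : set R)); first exact: measurable_indic.
by apply/funext => u; rewrite indicE mem_setE in_itv/= andbT.
Qed.

Lemma integral_ind_ge0_shift (x : R) (f : R -> R) : (forall y, 0 <= f y) ->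
  measurable_fun [set: R] f ->
  (\int[mu]_y (ind_ge0 (y - x) * f y)%:E = \int[mu]_(u in `]0%R, +oo[) (f (x + u))%:E)%E.
Proof.
move=> f0 mf; rewrite (ge0_integral_affine 1 x)//; last 2 first.
- apply/measurable_EFinP; apply: measurable_funM => //.
  apply: (measurableT_comp measurable_ind_ge0).
  by apply: measurable_funB.
- by move=> y; rewrite lee_fin mulr_ge0// ind_ge0_ge0.
rewrite integral_itv_obnd_cbnd; last first.
  apply/measurable_EFinP; apply: measurable_funTS; apply: measurableT_comp => //.
  exact: measurable_funD.
rewrite mul1e [RHS]integral_mkcond; apply: eq_integral => u _.
rewrite patchE mem_setE in_itv/= andbT /ind_ge0 mul1r addrK [u + x]addrC.
by case: ifP => _; rewrite ?mul1r ?mul0r.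
Qed.

Lemma measurable_yslice (F : R * R -> R) (y : R) : measurable_fun [set: R * R] F ->
  measurable_fun [set: R] (fun x => F (x, y)).
Proof. by move=> mF; apply: measurableT_comp => //; exact: pair2_measurable. Qed.

(** For comparisons, such as the tail moment bound, that hold only after integrating out the second
    point. *)
Lemma double_integral_le_inner (F G : R * R -> R) : measurable_fun [set: R * R] F ->
  measurable_fun [set: R * R] G ->
  (forall z, 0 <= F z) -> (forall z, 0 <= G z) ->
  (forall x, \int[mu]_y (F (x, y))%:E <= \int[mu]_y (G (x, y))%:E)%E ->
  (\int[mu2]_z (F z)%:E <= \int[mu2]_z (G z)%:E)%E.
Proof.
move=> mF mG F0 G0 FG; rewrite !double_integral_xy//.
have meas (H : R * R -> R) : measurable_fun [set: R * R] H -> (forall z, 0 <= H z) ->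
    measurable_fun [set: R] (fun x => \int[mu]_y (H (x, y))%:E)%E.
  move=> mH H0.
  have mHE : measurable_fun [set: R * R] (EFin \o H) by exact/measurable_EFinP.
  by apply: (@measurable_fun_fubini_tonelli_F _ _ _ _ _ mu (EFin \o H)).
apply: ge0_le_integral => //.
- by move=> x _; apply: integral_ge0 => y _; rewrite lee_fin.
- exact: meas.
- exact: meas.
Qed.

(** The map [(x, y) -> (-y, -x)] preserves [y - x] while exchanging left and right; it carries
    results above [m] to results below it. *)
Lemma double_integral_oppr_swap (F : R * R -> R) : measurable_fun [set: R * R] F ->
  (forall z, 0 <= F z) ->
  (\int[mu2]_z (F z)%:E = \int[mu2]_z (F (- z.2, - z.1))%:E)%E.
Proof.
move=> mF F0.
have mFE : measurable_fun [set: R * R] (EFin \o F) by exact/measurable_EFinP.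
have mFo : measurable_fun [set: R * R] (fun z => F (- z.2, - z.1)).
  apply: measurableT_comp => //; apply: measurable_fun_pair => /=.
    exact: measurable_funN.
  exact: measurable_funN.
rewrite double_integral_yx// double_integral_xy//.
rewrite ge0_integral_oppr; last 2 first.
- by apply: (@measurable_fun_fubini_tonelli_G _ _ _ _ _ mu (EFin \o F)).
- by move=> y; apply: integral_ge0 => x _; rewrite lee_fin.
apply: eq_integral => y _; rewrite ge0_integral_oppr//.
by apply/measurable_EFinP; exact: measurable_yslice.
by move=> x; rewrite lee_fin.
Qed.

(** For a fixed lower point [x >= m], the tail bound replaces [(y - x)^a] by a constant times the
    indicator of [y > x]; what remains is half of a product mass. The factor 2 on the left records
    that half without a division. *)
Lemma right_half_moment (a m rho : R) (f : R -> R) : 0 < a ->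
  (forall y, 0 <= f y) -> log_concave f -> measurable_fun [set: R] f -> 0 < rho ->
  (\int[mu]_y (ind_ge0 (y - m) * f y)%:E < (f m * rho)%:E)%E ->
  (2%:E * \int[mu2]_z (ind_ge0 (z.1 - m) * (f z.1 * (pospow a (z.2 - z.1) * f z.2)))%:E <=
   (Gamma (a + 1) * rho `^ a)%:E *
   (\int[mu]_y (ind_ge0 (y - m) * f y)%:E * \int[mu]_y (ind_ge0 (y - m) * f y)%:E))%E.
Proof.
move=> a0 f0 lc mf rho0 hm.
have C0 : 0 <= Gamma (a + 1) * rho `^ a by rewrite mulr_ge0 ?Gamma_ge0 ?powR_ge0.
set C := Gamma _ * _ in C0 *.
pose h y := ind_ge0 (y - m) * f y.
have h0 y : 0 <= h y by rewrite mulr_ge0 ?ind_ge0_ge0.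
have mnm : measurable_fun [set: R] (fun y => ind_ge0 (y - m)).
  by apply: (measurableT_comp measurable_ind_ge0); apply: measurable_funB.
have mh : measurable_fun [set: R] h by exact: measurable_funM.
have hfin : (\int[mu]_y (h y)%:E < +oo)%E by rewrite (lt_trans hm)// ltry.
pose F (z : R * R) := ind_ge0 (z.1 - m) * (f z.1 * (pospow a (z.2 - z.1) * f z.2)).
pose G (z : R * R) := C * (ind_ge0 (z.1 - m) * (f z.1 * (ind_gt0 (z.2 - z.1) * f z.2))).
have mf1 := measurable_fst_comp _ mf; have mf2 := measurable_snd_comp _ mf.
have mn1 := measurable_fst_comp _ mnm.
have mpp := measurable_sub_comp _ (measurable_pospow a).
have mp := measurable_sub_comp _ (@measurable_ind_gt0 R).
have mF : measurable_fun [set: R * R] F.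
  exact: (measurable_funM mn1 (measurable_funM mf1 (measurable_funM mpp mf2))).
have mG : measurable_fun [set: R * R] G.
  apply: measurable_funM => //.
  exact: (measurable_funM mn1 (measurable_funM mf1 (measurable_funM mp mf2))).
have F0 z : 0 <= F z.
  by do 3 (apply: mulr_ge0; rewrite ?ind_ge0_ge0 ?pospow_ge0 ?f0//).
have G0 z : 0 <= G z.
  apply: mulr_ge0 => //.
  by do 3 (apply: mulr_ge0; rewrite ?ind_ge0_ge0 ?ind_gt0_ge0 ?f0//).
have mposx (x : R) : measurable_fun [set: R] (fun y => ind_gt0 (y - x)).
  by apply: (measurableT_comp (@measurable_ind_gt0 R)); apply: measurable_funB.
have mpowx (x : R) : measurable_fun [set: R] (fun y => pospow a (y - x)).
  by apply: (measurableT_comp (measurable_pospow a)); apply: measurable_funB.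
have FG : (\int[mu2]_z (F z)%:E <= \int[mu2]_z (G z)%:E)%E.
  apply: double_integral_le_inner => // x; rewrite /F /G/=.
  rewrite /ind_ge0 subr_ge0; have [mx|xm] := leP m x; last first.
    by under eq_integral do rewrite mul0r; rewrite integral0 integral_ge0// => y _;
      rewrite mul0r mulr0.
  under eq_integral do rewrite mul1r.
  under [leRHS]eq_integral do rewrite mul1r mulrCA.
  have mpf : measurable_fun [set: R] (fun y => pospow a (y - x) * f y).
    exact: measurable_funM.
  have mqf : measurable_fun [set: R] (fun y => ind_gt0 (y - x) * f y).
    exact: measurable_funM.
  rewrite !ge0_integralZl_real//; try by move=> *; rewrite ?mulr_ge0 ?pospow_ge0 ?ind_gt0_ge0.
  - rewrite lee_wpmul2l ?lee_fin// integral_pospow_shift// integral_ind_gt0_shift//.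
    by apply: (log_concave_tail_moment a m) => //; rewrite -integral_ind_ge0_shift.
  - exact: measurable_funM.
  - by move=> y _; apply: mulr_ge0 => //; apply: mulr_ge0; rewrite ?ind_gt0_ge0.
apply: (@le_trans _ _ (2%:E * \int[mu2]_z (G z)%:E)%E).
  by rewrite lee_wpmul2l.
(* If [m <= z.1 < z.2] then also [m <= z.2], so the second point may be given the same indicator,
   which makes the integrand symmetric up to [ind_gt0]. *)
have GE : (\int[mu2]_z (G z)%:E =
    C%:E * \int[mu2]_z (ind_gt0 (z.2 - z.1) * (h z.1 * h z.2))%:E)%E.
  have mhh : measurable_fun [set: R * R] (fun z => ind_gt0 (z.2 - z.1) * (h z.1 * h z.2)).
    apply: measurable_funM => //.
    by apply: measurable_funM; [exact: measurable_fst_comp|exact: measurable_snd_comp].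
  under eq_integral => z _.
    rewrite /G (_ : ind_ge0 (z.1 - m) * _ = ind_gt0 (z.2 - z.1) * (h z.1 * h z.2)).
      rewrite EFinM; over.
    rewrite /h /ind_gt0 /ind_ge0 !subr_ge0 subr_gt0.
    have [mz|] := leP m z.1; last by rewrite !(mul0r, mulr0).
    have [zz|] := ltP z.1 z.2; last by rewrite !(mul0r, mulr0).
    by rewrite (le_trans mz (ltW zz)) !mul1r.
  rewrite ge0_integralZl//; first exact/measurable_EFinP.
  by move=> z _; rewrite lee_fin !mulr_ge0 ?ind_gt0_ge0.
rewrite GE muleCA lee_wpmul2l ?lee_fin//.
exact: double_integral_half_plane.
Qed.

End pairwise_moment.

(** * Reflection to the left of [m], and convexity of powers *)

Section opposite_side.
Context {R : realType}.
Local Notation mu := (@lebesgue_measure R).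
Local Notation mu2 := (mu \x mu)%E.

Lemma integral_ind_ge0_oppr (m : R) (f : R -> R) : (forall y, 0 <= f y) ->
  measurable_fun [set: R] f ->
  (\int[mu]_y (ind_ge0 (y - - m) * f (- y))%:E = \int[mu]_y (ind_ge0 (m - y) * f y)%:E)%E.
Proof.
move=> f0 mf; rewrite [RHS]ge0_integral_oppr//.
- by apply: eq_integral => y _; rewrite !opprK addrC.
- apply/measurable_EFinP; apply: measurable_funM => //.
  by apply: (measurableT_comp (@measurable_ind_ge0 R)); apply: measurable_funB.
- by move=> y; rewrite lee_fin mulr_ge0 ?ind_ge0_ge0.
Qed.

(** [right_half_moment] for [u -> f (- u)] at [- m]. After reflection the upper point [z.2] is the
    one constrained by the indicator. *)
Lemma left_half_moment (a m rho : R) (f : R -> R) : 0 < a ->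
  (forall y, 0 <= f y) -> log_concave f -> measurable_fun [set: R] f -> 0 < rho ->
  (\int[mu]_y (ind_ge0 (m - y) * f y)%:E < (f m * rho)%:E)%E ->
  (2%:E * \int[mu2]_z (ind_ge0 (m - z.2) * (f z.2 * (pospow a (z.2 - z.1) * f z.1)))%:E <=
   (Gamma (a + 1) * rho `^ a)%:E *
   (\int[mu]_y (ind_ge0 (m - y) * f y)%:E * \int[mu]_y (ind_ge0 (m - y) * f y)%:E))%E.
Proof.
move=> a0 f0 lc mf rho0 hm.
have mfo : measurable_fun [set: R] (fun u => f (- u)).
  by apply: measurableT_comp => //; exact: oppr_measurable.
have := right_half_moment a (- m) rho (fun u => f (- u)) a0
  (fun y => f0 _) (log_concave_oppr f lc) mfo rho0.
rewrite integral_ind_ge0_oppr// opprK => /(_ hm).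
apply: le_trans; rewrite lee_wpmul2l//.
rewrite double_integral_oppr_swap/=.
- rewrite le_eqVlt; apply/orP; left; apply/eqP; apply: eq_integral => z _.
  by rewrite !opprK [- z.1 + z.2]addrC [m + z.1]addrC.
- have mn : measurable_fun [set: R] (fun y => ind_ge0 (m - y)).
    by apply: (measurableT_comp (@measurable_ind_ge0 R)); apply: measurable_funB.
  exact: (measurable_funM (measurable_snd_comp _ mn) (measurable_funM
    (measurable_snd_comp _ mf) (measurable_funM
    (measurable_sub_comp _ (measurable_pospow a)) (measurable_fst_comp _ mf)))).
- by move=> z; do 3 (apply: mulr_ge0; rewrite ?ind_ge0_ge0 ?pospow_ge0 ?f0//).
Qed.

(* Young's inequality, read as: the convex function [u `^ a] is above its tangent at [c]. *)
Lemma powR_tangent (a u c : R) : 1 <= a -> 0 <= u -> 0 <= c ->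
  a * c `^ (a - 1) * u <= u `^ a + (a - 1) * c `^ a.
Proof.
move=> a1 u0 c0; have [->|aN1] := eqVneq a 1.
  by rewrite subrr powRr0 powRr1// !mul0r addr0 !mul1r.
have a_gt1 : 1 < a by rewrite lt_neqAle eq_sym aN1.
have a0 : 0 < a by lra.
have am0 : 0 < a - 1 by lra.
have := @conjugate_powR R u (c `^ (a - 1)) a (a / (a - 1)) u0 (powR_ge0 _ _) a0
  (divr_gt0 a0 am0).
rewrite -powRrM (_ : (a - 1) * _ = a); last by field; lra.
move=> H; have : u * c `^ (a - 1) <= u `^ a / a + c `^ a / (a / (a - 1)).
  by apply: H; field; lra.
rewrite -(ler_pM2l a0) => H'.
rewrite -mulrA [X in a * X]mulrC; apply: (le_trans H').
by rewrite le_eqVlt; apply/orP; left; apply/eqP; field; lra.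
Qed.

(** Convexity with weights [r s] and [r t] at the points [u / s] and [v / t], whose weighted mean is
    [z = r (u + v)]. The tangents at [z] are added; their linear parts sum to [a z^a]. *)
Lemma powR_add_le (a r u v s t : R) : 1 <= a -> 0 < r -> 0 < s -> 0 < t ->
  s + t = r^-1 -> 0 <= u -> 0 <= v ->
  (u + v) `^ a <= r^-1 `^ a * (r * s * (s^-1 `^ a * u `^ a) +
                               r * t * (t^-1 `^ a * v `^ a)).
Proof.
move=> a1 r0 s0 t0 st u0 v0.
have rst : r * s + r * t = 1 by rewrite -mulrDr st divff// gt_eqF.
have [sV tV rV] : [/\ 0 <= s^-1, 0 <= t^-1 & 0 <= r^-1] by rewrite !invr_ge0 !ltW.
have rs0 : 0 < r * s by apply: mulr_gt0.
have rt0 : 0 < r * t by apply: mulr_gt0.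
pose z := r * (u + v).
have z0 : 0 <= z by rewrite mulr_ge0 ?addr_ge0// ltW.
have -> : u + v = r^-1 * z by rewrite /z mulrA mulVf ?mul1r// gt_eqF.
rewrite powRM// ler_wpM2l ?powR_ge0// -!powRM//.
have h1 := powR_tangent a (s^-1 * u) z a1 (mulr_ge0 sV u0) z0.
have h2 := powR_tangent a (t^-1 * v) z a1 (mulr_ge0 tV v0) z0.
have za : a * z `^ (a - 1) * z = a * z `^ a.
  by rewrite -mulrA [_ * z]mulrC mulr_powRB1//; lra.
have h1' := ler_wpM2l (ltW rs0) h1.
have h2' := ler_wpM2l (ltW rt0) h2.
have h3 := lerD h1' h2'.
have e1 : r * s * (a * z `^ (a - 1) * (s^-1 * u)) + r * t * (a * z `^ (a - 1) * (t^-1 * v))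
   = a * z `^ (a - 1) * z.
  by rewrite /z; field; rewrite !gt_eqF.
rewrite e1 za in h3.
have e2 : r * s * ((s^-1 * u) `^ a + (a - 1) * z `^ a) +
          r * t * ((t^-1 * v) `^ a + (a - 1) * z `^ a) =
  (r * s * (s^-1 * u) `^ a + r * t * (t^-1 * v) `^ a) + (r * s + r * t) * ((a - 1) * z `^ a).
  by ring.
by rewrite e2 rst mul1r in h3; lra.
Qed.

End opposite_side.

(** * The bound for all pairs *)

Section pairwise_bound.
Context {R : realType}.
Local Notation mu := (@lebesgue_measure R).
Local Notation mu2 := (mu \x mu)%E.

(* [s] and [t] are slightly larger than [A / f m] and [B / f m]; the excess makes
   the hypotheses [A < f m * s] and [B < f m * t] strict. *)
Lemma double_integral_mid (a m r s t A B : R) (f : R -> R) : 1 <= a ->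
  (forall y, 0 <= f y) -> log_concave f -> measurable_fun [set: R] f ->
  0 < r -> 0 < s -> 0 < t -> s + t = r^-1 ->
  (\int[mu]_y (ind_ge0 (y - m) * f y)%:E = A%:E)%E ->
  (\int[mu]_y (ind_ge0 (m - y) * f y)%:E = B%:E)%E ->
  A < f m * s -> B < f m * t ->
  (\int[mu2]_z (ind_ge0 (m - z.1) * ind_ge0 (z.2 - m) *
      (f z.1 * (pospow a (z.2 - z.1) * f z.2)))%:E <=
   (Gamma (a + 1) * r^-1 `^ a * (A * B))%:E)%E.
Proof.
move=> a1 f0 lc mf r0 s0 t0 st hA hB As Bt.
have a0 : 0 < a by lra.
have A0 : 0 <= A.
  by rewrite -lee_fin -hA integral_ge0// => y _; rewrite lee_fin mulr_ge0 ?ind_ge0_ge0.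
have B0 : 0 <= B.
  by rewrite -lee_fin -hB integral_ge0// => y _; rewrite lee_fin mulr_ge0 ?ind_ge0_ge0.
have mnR : measurable_fun [set: R] (fun y => ind_ge0 (y - m)).
  by apply: (measurableT_comp (@measurable_ind_ge0 R)); apply: measurable_funB.
have mnL : measurable_fun [set: R] (fun y => ind_ge0 (m - y)).
  by apply: (measurableT_comp (@measurable_ind_ge0 R)); apply: measurable_funB.
have mpR : measurable_fun [set: R] (fun y => pospow a (y - m)).
  by apply: (measurableT_comp (measurable_pospow a)); apply: measurable_funB.
have mpL : measurable_fun [set: R] (fun y => pospow a (m - y)).
  by apply: (measurableT_comp (measurable_pospow a)); apply: measurable_funB.
pose nR y := ind_ge0 (y - m) * f y; pose nL y := ind_ge0 (m - y) * f y.
pose pR y := pospow a (y - m) * f y; pose pL y := pospow a (m - y) * f y.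
have mnRf : measurable_fun [set: R] nR by exact: measurable_funM.
have mnLf : measurable_fun [set: R] nL by exact: measurable_funM.
have mpRf : measurable_fun [set: R] pR by exact: measurable_funM.
have mpLf : measurable_fun [set: R] pL by exact: measurable_funM.
have nR0 y : 0 <= nR y by rewrite mulr_ge0 ?ind_ge0_ge0.
have nL0 y : 0 <= nL y by rewrite mulr_ge0 ?ind_ge0_ge0.
have pR0 y : 0 <= pR y by apply: mulr_ge0; rewrite ?pospow_ge0.
have pL0 y : 0 <= pL y by apply: mulr_ge0; rewrite ?pospow_ge0.
have KR : (\int[mu]_y (pR y)%:E <= (Gamma (a + 1) * s `^ a * A)%:E)%E.
  rewrite integral_pospow_shift// EFinM -hA integral_ind_ge0_shift//.
  by apply: (log_concave_tail_moment a m) => //; rewrite -integral_ind_ge0_shift// hA lte_fin.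
have KL : (\int[mu]_y (pL y)%:E <= (Gamma (a + 1) * t `^ a * B)%:E)%E.
  have mfo : measurable_fun [set: R] (fun u => f (- u)).
    by apply: measurableT_comp => //; exact: oppr_measurable.
  have -> : (\int[mu]_y (pL y)%:E =
      \int[mu]_y (pospow a (y - - m) * f (- y))%:E)%E.
    transitivity (\int[mu]_y (pL (- y))%:E)%E.
      apply: (ge0_integral_oppr (EFin \o pL)); first exact/measurable_EFinP.
      by move=> y; rewrite lee_fin.
    by apply: eq_integral => y _; rewrite /pL !opprK addrC.
  rewrite integral_pospow_shift// EFinM -hB -integral_ind_ge0_oppr// integral_ind_ge0_shift//.
  apply: (log_concave_tail_moment a (- m) (- m) t (fun u => f (- u))) => //.
    exact: log_concave_oppr.
  rewrite -(integral_ind_ge0_shift (- m) (fun u => f (- u)))//.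
  by rewrite integral_ind_ge0_oppr// hB opprK lte_fin.
have KRfin : (\int[mu]_y (pR y)%:E < +oo)%E by rewrite (le_lt_trans KR)// ltry.
have KLfin : (\int[mu]_y (pL y)%:E < +oo)%E by rewrite (le_lt_trans KL)// ltry.
(* The coefficients of [powR_add_le]. The one-sided moments bring factors [s^a] and [t^a], and
   [c1 s^a + c2 t^a = r^(-a)]. *)
pose c1 := r^-1 `^ a * (r * s * s^-1 `^ a).
pose c2 := r^-1 `^ a * (r * t * t^-1 `^ a).
have c10 : 0 <= c1.
  by rewrite mulr_ge0 ?powR_ge0// mulr_ge0 ?powR_ge0// mulr_ge0// ltW.
have c20 : 0 <= c2.
  by rewrite mulr_ge0 ?powR_ge0// mulr_ge0 ?powR_ge0// mulr_ge0// ltW.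
pose c1nL y := c1 * nL y; pose c2pL y := c2 * pL y.
have c1nL0 y : 0 <= c1nL y by exact: mulr_ge0.
have c2pL0 y : 0 <= c2pL y by exact: mulr_ge0.
have mc1nL : measurable_fun [set: R] c1nL by exact: measurable_funM.
have mc2pL : measurable_fun [set: R] c2pL by exact: measurable_funM.
have mprod (g h : R -> R) : measurable_fun [set: R] g -> measurable_fun [set: R] h ->
    measurable_fun [set: R * R] (fun z => g z.1 * h z.2).
  by move=> mg mh; apply: measurable_funM;
    [exact: measurable_fst_comp|exact: measurable_snd_comp].
(* Writing [y - x = (y - m) + (m - x)] separates the variables: each summand integrates to the mass
   of one side times the moment of the other. *)
apply: (@le_trans _ _ (\int[mu2]_z (c1nL z.1 * pR z.2 + c2pL z.1 * nR z.2)%:E)%E).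
  apply: double_integral_le.
  - exact: (measurable_funM (mprod _ _ mnL mnR) (measurable_funM
      (measurable_fst_comp _ mf) (measurable_funM
      (measurable_sub_comp _ (measurable_pospow a)) (measurable_snd_comp _ mf)))).
  - exact: (measurable_funD (mprod _ _ mc1nL mpRf) (mprod _ _ mc2pL mnRf)).
  - move=> z; apply: mulr_ge0; first by rewrite mulr_ge0 ?ind_ge0_ge0.
    by do 2 (apply: mulr_ge0; rewrite ?pospow_ge0 ?f0//).
  - move=> [x y] /=.
    have R0 : 0 <= c1nL x * pR y + c2pL x * nR y by rewrite addr_ge0// mulr_ge0.
    have [xm|xm] := leP x m; last first.
      have -> : ind_ge0 (m - x) = 0 by rewrite /ind_ge0 subr_ge0 leNgt xm.
      by rewrite !mul0r.
    have [my|my] := leP m y; last first.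
      have -> : ind_ge0 (y - m) = 0 by rewrite /ind_ge0 subr_ge0 leNgt my.
      by rewrite mulr0 !mul0r.
    rewrite /c1nL /c2pL /nL /nR /pL /pR /ind_ge0 !subr_ge0 xm my !mul1r.
    have H : pospow a (y - x) <=
        c1 * pospow a (y - m) + c2 * pospow a (m - x).
      rewrite /pospow !max_l ?subr_ge0//; last exact: le_trans my.
      have -> : y - x = (y - m) + (m - x) by ring.
      have := powR_add_le a r (y - m) (m - x) s t a1 r0 s0 t0 st.
      rewrite !subr_ge0 => /(_ my xm); rewrite /c1 /c2.
      by move=> /le_trans; apply; rewrite le_eqVlt; apply/orP; left; apply/eqP; ring.
    have ff : 0 <= f x * f y by rewrite mulr_ge0.
    by have := ler_wpM2r ff H; lra.
rewrite double_integralD.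
- have nRfin : (\int[mu]_y (nR y)%:E < +oo)%E by rewrite hA ltry.
  rewrite (double_integral_prod c1nL pR)// (double_integral_prod c2pL nR)// hA.
  rewrite !ge0_integralZl_real// hB.
  have K1 : (c1%:E * B%:E * \int[mu]_x (pR x)%:E <=
     (c1 * B * (Gamma (a + 1) * s `^ a * A))%:E)%E.
    by rewrite -EFinM [leRHS]EFinM lee_wpmul2l// lee_fin mulr_ge0.
  have K2 : (c2%:E * \int[mu]_x (pL x)%:E * A%:E <=
     (c2 * (Gamma (a + 1) * t `^ a * B) * A)%:E)%E.
    by rewrite [leRHS]EFinM lee_wpmul2r ?lee_fin// [leRHS]EFinM lee_wpmul2l.
  apply: (le_trans (leeD K1 K2)); rewrite -EFinD lee_fin.
  have ss : s^-1 `^ a * s `^ a = 1.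
    by rewrite -powRM ?invr_ge0 ?(ltW s0)// mulVf ?gt_eqF// powR1.
  have tt : t^-1 `^ a * t `^ a = 1.
    by rewrite -powRM ?invr_ge0 ?(ltW t0)// mulVf ?gt_eqF// powR1.
  have rst : r * s + r * t = 1 by rewrite -mulrDr st divff// gt_eqF.
  rewrite le_eqVlt; apply/orP; left; apply/eqP; rewrite /c1 /c2.
  transitivity (r^-1 `^ a * Gamma (a + 1) * A * B *
    (r * s * (s^-1 `^ a * s `^ a) + r * t * (t^-1 `^ a * t `^ a))); first by ring.
  by rewrite ss tt !mulr1 rst; ring.
- exact: mprod.
- exact: mprod.
- by move=> z; exact: mulr_ge0.
- by move=> z; exact: mulr_ge0.
Qed.

Lemma pairwise_moment (a m r : R) (f : R -> R) : 1 <= a -> is_pdf f ->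
  log_concave f -> 0 < r -> r < f m ->
  (\int[mu2]_z (f z.1 * (f z.2 * `|z.2 - z.1| `^ a))%:E <=
   (Gamma (a + 1) * r^-1 `^ a)%:E)%E.
Proof.
move=> a1 [mf f0 f1] lc r0 rf; have a0 : 0 < a by lra.
have fm0 : 0 < f m by lra.
have mnR : measurable_fun [set: R] (fun y => ind_ge0 (y - m)).
  by apply: (measurableT_comp (@measurable_ind_ge0 R)); apply: measurable_funB.
have mnL : measurable_fun [set: R] (fun y => ind_ge0 (m - y)).
  by apply: (measurableT_comp (@measurable_ind_ge0 R)); apply: measurable_funB.
have mp0 : measurable_fun [set: R] (fun y => ind_gt0 (y - m)).
  by apply: (measurableT_comp (@measurable_ind_gt0 R)); apply: measurable_funB.
have nRf0 y : 0 <= ind_ge0 (y - m) * f y by rewrite mulr_ge0 ?ind_ge0_ge0.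
have nLf0 y : 0 <= ind_ge0 (m - y) * f y by rewrite mulr_ge0 ?ind_ge0_ge0.
have pf0 y : 0 <= ind_gt0 (y - m) * f y by rewrite mulr_ge0 ?ind_gt0_ge0.
have AB1 : (\int[mu]_y (ind_ge0 (y - m) * f y)%:E + \int[mu]_y (ind_ge0 (m - y) * f y)%:E = 1)%E.
  rewrite integral_ind_ge0_shift// -integral_ind_gt0_shift// -ge0_integralD_real//.
  - rewrite -f1; apply: eq_integral => y _; congr EFin.
    rewrite -mulrDl /ind_gt0 /ind_ge0 subr_gt0 subr_ge0.
    by case: ltP => _; rewrite ?addr0 ?add0r mul1r.
  - exact: measurable_funM.
  - exact: measurable_funM.
have IA0 : (0 <= \int[mu]_y (ind_ge0 (y - m) * f y)%:E)%E.
  by apply: integral_ge0 => y _; rewrite lee_fin.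
have IB0 : (0 <= \int[mu]_y (ind_ge0 (m - y) * f y)%:E)%E.
  by apply: integral_ge0 => y _; rewrite lee_fin.
have IAfin : (\int[mu]_y (ind_ge0 (y - m) * f y)%:E)%E \is a fin_num.
  rewrite ge0_fin_numE//; apply: (@le_lt_trans _ _ 1%E); last exact: ltry.
  by rewrite -AB1 leeDl.
have IBfin : (\int[mu]_y (ind_ge0 (m - y) * f y)%:E)%E \is a fin_num.
  rewrite ge0_fin_numE//; apply: (@le_lt_trans _ _ 1%E); last exact: ltry.
  by rewrite -AB1 leeDr.
have [A hA] : exists A, (\int[mu]_y (ind_ge0 (y - m) * f y)%:E = A%:E)%E.
  by exists (fine (\int[mu]_y (ind_ge0 (y - m) * f y)%:E)%E); rewrite fineK.
have [B hB] : exists B, (\int[mu]_y (ind_ge0 (m - y) * f y)%:E = B%:E)%E.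
  by exists (fine (\int[mu]_y (ind_ge0 (m - y) * f y)%:E)%E); rewrite fineK.
have A0 : 0 <= A by rewrite -lee_fin -hA.
have B0 : 0 <= B by rewrite -lee_fin -hB.
have AB : A + B = 1.
  by move: AB1; rewrite hA hB -EFinD => -[].
have fmr : (f m)^-1 < r^-1 by rewrite ltf_pV2.
(* Half of the slack goes to each side, so that [s + t = 1 / r] exactly. *)
pose dl := (r^-1 - (f m)^-1) / 2.
have dl0 : 0 < dl by rewrite /dl; lra.
have fV0 : 0 < (f m)^-1 by rewrite invr_gt0.
pose s := A / f m + dl; pose t := B / f m + dl.
have s0 : 0 < s by rewrite ltr_wpDl// mulr_ge0// ltW.
have t0 : 0 < t by rewrite ltr_wpDl// mulr_ge0// ltW.
have st : s + t = r^-1.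
  have : A / f m + B / f m = (f m)^-1 by rewrite -mulrDl AB mul1r.
  by rewrite /s /t /dl; lra.
have As : A < f m * s.
  by rewrite /s mulrDr mulrCA divff ?gt_eqF// mulr1 ltrDl mulr_gt0.
have Bt : B < f m * t.
  by rewrite /t mulrDr mulrCA divff ?gt_eqF// mulr1 ltrDl mulr_gt0.
have hmid := double_integral_mid a m r s t A B f a1 f0 lc mf r0 s0 t0 st hA hB As Bt.
have hR := right_half_moment a m s f a0 f0 lc mf s0.
rewrite hA lte_fin in hR; move/(_ As) in hR.
have hL := left_half_moment a m t f a0 f0 lc mf t0.
rewrite hB lte_fin in hL; move/(_ Bt) in hL.
have rs : s `^ a <= r^-1 `^ a.
  by apply: ge0_ler_powR; rewrite ?nnegrE ?invr_ge0 ?(ltW a0) ?(ltW r0) ?(ltW s0)//; lra.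
have rt : t `^ a <= r^-1 `^ a.
  by apply: ge0_ler_powR; rewrite ?nnegrE ?invr_ge0 ?(ltW a0) ?(ltW r0) ?(ltW t0)//; lra.
have G0 := Gamma_ge0 (a + 1).
set rr := r^-1 `^ a in hmid rs rt *.
set G := Gamma (a + 1) in hmid hR hL G0 *.
pose W (z : R * R) := f z.1 * (f z.2 * pospow a (z.2 - z.1)).
pose W1 (z : R * R) := ind_ge0 (z.1 - m) * (f z.1 * (pospow a (z.2 - z.1) * f z.2)).
pose W2 (z : R * R) := ind_ge0 (m - z.2) * (f z.2 * (pospow a (z.2 - z.1) * f z.1)).
pose W3 (z : R * R) := ind_ge0 (m - z.1) * ind_ge0 (z.2 - m) *
      (f z.1 * (pospow a (z.2 - z.1) * f z.2)).
have m1 := measurable_fst_comp _ mf; have m2 := measurable_snd_comp _ mf.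
have mpp := measurable_sub_comp _ (measurable_pospow a).
have mW : measurable_fun [set: R * R] W.
  exact: (measurable_funM m1 (measurable_funM m2 mpp)).
have mW1 : measurable_fun [set: R * R] W1.
  exact: (measurable_funM (measurable_fst_comp _ mnR)
    (measurable_funM m1 (measurable_funM mpp m2))).
have mW2 : measurable_fun [set: R * R] W2.
  exact: (measurable_funM (measurable_snd_comp _ mnL)
    (measurable_funM m2 (measurable_funM mpp m1))).
have mW3 : measurable_fun [set: R * R] W3.
  exact: (measurable_funM (measurable_funM (measurable_fst_comp _ mnL)
    (measurable_snd_comp _ mnR)) (measurable_funM m1 (measurable_funM mpp m2))).
have W0 z : 0 <= W z by do 2 (apply: mulr_ge0; rewrite ?pospow_ge0 ?f0//).
have W10 z : 0 <= W1 z.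
  by do 3 (apply: mulr_ge0; rewrite ?ind_ge0_ge0 ?pospow_ge0 ?f0//).
have W20 z : 0 <= W2 z.
  by do 3 (apply: mulr_ge0; rewrite ?ind_ge0_ge0 ?pospow_ge0 ?f0//).
have W30 z : 0 <= W3 z.
  apply: mulr_ge0; first by rewrite mulr_ge0 ?ind_ge0_ge0.
  by do 2 (apply: mulr_ge0; rewrite ?pospow_ge0 ?f0//).
(* Every pair has [z.1 >= m], or [z.2 <= m], or [z.1 < m < z.2]. The factor [pospow] restricts all
   four integrands to pairs with [z.1 < z.2]. *)
have WW : (\int[mu2]_z (W z)%:E <= \int[mu2]_z (W1 z)%:E + \int[mu2]_z (W2 z)%:E +
    \int[mu2]_z (W3 z)%:E)%E.
  have mW12 : measurable_fun [set: R * R] (fun z => W1 z + W2 z).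
    exact: measurable_funD.
  rewrite -double_integralD// -double_integralD//; last by move=> z; rewrite addr_ge0.
  apply: double_integral_le => //; first exact: (measurable_funD mW12 mW3).
  move=> z.
  have E1 : ind_ge0 (z.1 - m) = 1 -> W1 z = W z by move=> e; rewrite /W1 /W e; ring.
  have E2 : ind_ge0 (m - z.2) = 1 -> W2 z = W z by move=> e; rewrite /W2 /W e; ring.
  have E3 : ind_ge0 (m - z.1) = 1 -> ind_ge0 (z.2 - m) = 1 -> W3 z = W z.
    by move=> e e'; rewrite /W3 /W e e'; ring.
  have := W0 z; have := W10 z; have := W20 z; have := W30 z.
  have [mz|mz] := leP m z.1; first by rewrite E1 ?/ind_ge0 ?subr_ge0 ?mz//; lra.
  have [zm|zm] := leP z.2 m; first by rewrite E2 ?/ind_ge0 ?subr_ge0 ?zm//; lra.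
  by rewrite E3 ?/ind_ge0 ?subr_ge0 ?(ltW mz) ?(ltW zm)//; lra.
have half (x : \bar R) c : (2%:E * x <= (2 * c)%:E)%E -> (x <= c%:E)%E.
  by rewrite EFinM lee_pmul2l.
have B1 : (\int[mu2]_z (W1 z)%:E <= (G * rr * (A * A) / 2)%:E)%E.
  apply: half; apply: (le_trans hR); rewrite -!EFinM lee_fin.
  rewrite (_ : 2 * _ = G * rr * (A * A)); last by field.
  by rewrite ler_wpM2r ?mulr_ge0// ler_wpM2l.
have B2 : (\int[mu2]_z (W2 z)%:E <= (G * rr * (B * B) / 2)%:E)%E.
  apply: half; apply: (le_trans hL); rewrite -!EFinM lee_fin.
  rewrite (_ : 2 * _ = G * rr * (B * B)); last by field.
  by rewrite ler_wpM2r ?mulr_ge0// ler_wpM2l.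
have WB : (\int[mu2]_z (W z)%:E <= (G * rr / 2)%:E)%E.
  apply: (le_trans WW); apply: (le_trans (leeD (leeD B1 B2) hmid)).
  rewrite -!EFinD lee_fin le_eqVlt; apply/orP; left; apply/eqP.
  (* The three parts contribute [A^2 / 2], [B^2 / 2] and [A B], which form a perfect square. *)
  transitivity (G * rr / 2 * (A + B) ^+ 2); first by rewrite expr2; field.
  by rewrite AB expr1n mulr1.
(* By symmetry, pairs with [z.1 > z.2] contribute as much as those with [z.1 < z.2]. *)
have -> : (\int[mu2]_z (f z.1 * (f z.2 * `|z.2 - z.1| `^ a))%:E =
    \int[mu2]_z (W z)%:E + \int[mu2]_z (W z)%:E)%E.
  rewrite [X in (_ + X)%E]double_integral_swap// -double_integralD//.
  - apply: eq_integral => z _; congr EFin.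
    by rewrite pospow_norm// opprB /W/=; ring.
  - by apply: measurableT_comp => //; exact: measurable_swap.
apply: (le_trans (leeD WB WB)); rewrite -EFinD lee_fin.
by rewrite -splitr.
Qed.

End pairwise_bound.

(** * From pairs to deviations from the mean *)

Section standard_deviation.
Context {d : measure_display} {T : measurableType d} {R : realType}.
Variables (P : probability T R) (X : {RV P >-> R}) (f : R -> R) (a : R).
Hypotheses (a1 : 1 <= a) (hf : is_pdf f) (hX : has_pdf X f).
Hypothesis hs : sigma X a \is a fin_num.
Local Notation mu := (@lebesgue_measure R).
Local Notation mu2 := (mu \x mu)%E.
Local Notation c := (fine 'E_P[X]).
Local Notation s := (fine (sigma X a)).

Let a0 : 0 < a. Proof. exact: lt_le_trans ltr01 a1. Qed.
Let f0 x : 0 <= f x. Proof. by have [_ + _] := hf; exact. Qed.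
Let mf : measurable_fun [set: R] f. Proof. by have [] := hf. Qed.
Let f1 : (\int[mu]_x (f x)%:E = 1)%E. Proof. by have [] := hf. Qed.

Lemma measurable_norm_powR (b e : R) : measurable_fun [set: R] (fun x => `|x - b| `^ e).
Proof.
apply: (measurableT_comp (@measurable_powR R e)).
by apply: measurableT_comp => //; exact: measurable_funB.
Qed.

Lemma sigma_ge0 : 0 <= s. Proof. by rewrite fine_ge0// poweR_ge0. Qed.

Let expE (Y : T -> R) : ('E_P[Y] = \int[P]_t (Y t)%:E)%E.
Proof. by rewrite unlock. Qed.

Lemma central_moment_pdf : (\int[mu]_x (f x * `|x - c| `^ a)%:E = (s `^ a)%:E)%E.
Proof.
rewrite -(ge0_expectation_pdf P X f hf hX (fun x => `|x - c| `^ a)); last 2 first.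
- exact: measurable_norm_powR.
- by move=> x; exact: powR_ge0.
have E0 : (0 <= \int[P]_t (`|X t - c| `^ a)%:E)%E.
  by apply: integral_ge0 => t _; rewrite lee_fin powR_ge0.
have := hs; rewrite /sigma (expE (fun t => `|X t - c| `^ a)) => hs'.
have Efin : (\int[P]_t (`|X t - c| `^ a)%:E)%E \is a fin_num.
  rewrite ge0_fin_numE//; apply: (lty_poweRy (r := a^-1)).
    by rewrite gt_eqF// invr_gt0.
  by rewrite -ge0_fin_numE// poweR_ge0.
rewrite fine_poweR -powRrM mulVf ?gt_eqF// powRr1 ?fine_ge0//.
by rewrite fineK.
Qed.

(** A vanishing moment would force [f = 0] almost everywhere off [c]; but a density puts no mass on
    a single point. *)
Lemma sigma_gt0 : 0 < s.
Proof.
rewrite lt_neqAle sigma_ge0 andbT; apply/negP => /eqP s0.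
have := central_moment_pdf; rewrite -s0 powR0 ?gt_eqF// => I0.
have mg : measurable_fun [set: R] (fun x => f x * `|x - c| `^ a).
  by apply: measurable_funM => //; exact: measurable_norm_powR.
have mgE : measurable_fun [set: R] (fun x => (f x * `|x - c| `^ a)%:E).
  exact/measurable_EFinP.
have ae0 : ae_eq mu [set: R] (fun x => (f x * `|x - c| `^ a)%:E) (cst 0%E).
  apply/ae_eq_integral_abs => //; rewrite -[RHS]I0.
  by apply: eq_integral => x _; rewrite gee0_abs// lee_fin mulr_ge0 ?powR_ge0.
have mD : measurable ([set: R] `\ c) by exact: measurableD.
have : (\int[mu]_(x in [set: R] `\ c) (f x)%:E = 0)%E.
  rewrite -(integral0 mu ([set: R] `\ c)); apply: ge0_ae_eq_integral => //.
  - by apply/measurable_EFinP; exact: measurable_funTS.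
  - by move=> x _; rewrite lee_fin.
  - apply: filterS ae0 => x /(_ I) /= [] /eqP; rewrite mulf_eq0 powR_eq0 normr_eq0 subr_eq0.
    by move=> /orP[/eqP ->//|/andP[/eqP -> _]] [_ /(_ erefl)].
rewrite integral_setD1; last first.
- by apply/measurable_EFinP; exact: measurable_funTS.
- exact: mD.
by rewrite f1 => /eqP; rewrite onee_eq0.
Qed.

Let mX : measurable_fun [set: T] X. Proof. exact: measurable_funPT. Qed.

Lemma integrable_central_moment :
  P.-integrable [set: T] (EFin \o (fun t => `|X t - c| `^ a)).
Proof.
have mXc : measurable_fun [set: T] (fun t => `|X t - c|).
  by apply: measurableT_comp => //; exact: measurable_funB.
have mXa : measurable_fun [set: T] (fun t => `|X t - c| `^ a).
  exact: (measurableT_comp (@measurable_powR R a) mXc).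
apply/integrableP; split; first exact/measurable_EFinP.
under eq_integral => t _ do rewrite /= ger0_norm ?powR_ge0//.
rewrite (ge0_expectation_pdf P X f hf hX (fun x => `|x - c| `^ a)).
- by rewrite central_moment_pdf ltry.
- exact: measurable_norm_powR.
- by move=> x; exact: powR_ge0.
Qed.

(** Beforehand [c] is only [fine] of an expectation that might be infinite. Since [u <= 1 + u^a],
    the finite moment about this number, whatever it is, dominates [X], and [c] turns out to be the
    true mean. *)
Lemma integrable_RV : P.-integrable [set: T] (EFin \o X).
Proof.
have int_b := integrableD measurableT
  (finite_measure_integrable_cst P (1 + `|c|) measurableT) integrable_central_moment.
apply: (le_integrable measurableT _ _ int_b); first exact/measurable_EFinP.
move=> t _ /=; rewrite lee_fin [leRHS]ger0_norm ?addr_ge0 ?powR_ge0//.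
have h1 : `|X t| <= `|X t - c| + `|c| by rewrite -{1}(subrK c (X t)) ler_normD.
have h2 : `|X t - c| <= 1 + `|X t - c| `^ a.
  have [u1|u1] := leP 1 `|X t - c|; first by have := le1r_powR u1 a1; lra.
  by have := powR_ge0 `|X t - c| a; lra.
by lra.
Qed.

Lemma expectation_fine : (\int[P]_t (X t)%:E = c%:E)%E.
Proof.
rewrite expE fineK//; apply: integrable_fin_num => //; exact: integrable_RV.
Qed.

Lemma norm_sub_mean_le (x : R) :
  (`|x - c|%:E <= \int[mu]_y (f y * `|y - x|)%:E)%E.
Proof.
rewrite -(ge0_expectation_pdf P X f hf hX (fun y => `|y - x|)); last 2 first.
- by apply: measurableT_comp => //; exact: measurable_funB.
- by move=> y; exact: normr_ge0.
have cst_int : P.-integrable [set: T] (EFin \o cst x) by exact: finite_measure_integrable_cst.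
have mXx : measurable_fun [set: T] (fun t => X t - x) by exact: measurable_funB.
have cI : (\int[P]_t (cst x t)%:E = x%:E)%E.
  by have := integral_cst P measurableT x%:E; rewrite /= probability_setT mule1.
have e : (\int[P]_t (X t - x)%:E = (c - x)%:E)%E.
  under eq_integral do rewrite EFinB.
  rewrite (@integralB_EFin _ _ _ P setT X (cst x))//; last exact: integrable_RV.
  by rewrite expectation_fine cI.
have := @le_abse_integral _ _ _ P setT (fun t => (X t - x)%:E) measurableT.
by rewrite e /= distrC; apply; exact/measurable_EFinP.
Qed.

(** Jensen by means of the tangent to [u^a] at [w]. Its slope is nonnegative, so the first-moment
    bound [norm_sub_mean_le] can be inserted. *)
Lemma jensen_pdf (x : R) :
  ((`|x - c| `^ a)%:E <= \int[mu]_y (f y * `|y - x| `^ a)%:E)%E.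
Proof.
set w := `|x - c|; have w0 : 0 <= w by exact: normr_ge0.
have mn : measurable_fun [set: R] (fun y => f y * `|y - x|).
  by apply: measurable_funM => //; apply: measurableT_comp => //; exact: measurable_funB.
have mna : measurable_fun [set: R] (fun y => f y * `|y - x| `^ a).
  by apply: measurable_funM => //; exact: measurable_norm_powR.
have fn0 y : 0 <= f y * `|y - x| by rewrite mulr_ge0.
have fna0 y : 0 <= f y * `|y - x| `^ a by rewrite mulr_ge0 ?powR_ge0.
have k0 : 0 <= a * w `^ (a - 1) by rewrite mulr_ge0 ?powR_ge0// ltW.
have l0 : 0 <= (a - 1) * w `^ a by rewrite mulr_ge0 ?powR_ge0// subr_ge0.
have wa : a * w `^ (a - 1) * w = w `^ a + (a - 1) * w `^ a.
  by rewrite -mulrA [_ * w]mulrC mulr_powRB1//; ring.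
have step : ((a * w `^ (a - 1))%:E * \int[mu]_y (f y * `|y - x|)%:E <=
    \int[mu]_y (f y * `|y - x| `^ a)%:E + ((a - 1) * w `^ a)%:E)%E.
  rewrite -[X in (_ + X)%E]mule1 -f1 -!ge0_integralZl_real//.
  rewrite -ge0_integralD_real//; last 2 first.
  - exact: measurable_funM.
  - by move=> y _; exact: mulr_ge0.
  apply: ge0_le_integral_real => //.
  - exact: measurable_funM.
  - by apply: measurable_funD => //; exact: measurable_funM.
  - by move=> y _; exact: mulr_ge0.
  - move=> y _; have := powR_tangent a `|y - x| w a1 (normr_ge0 _) w0.
    by move=> /(ler_wpM2l (f0 y)) H; lra.
rewrite -(leeD2rE _ _ (x := ((a - 1) * w `^ a)%:E))// -EFinD -wa.
apply: le_trans step; rewrite EFinM lee_wpmul2l ?lee_fin//.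
exact: norm_sub_mean_le.
Qed.

(** Averages over the first point a lower bound valid for each of its positions: [jensen_pdf] in
    general, [second_moment_pdf] for [a = 2]. *)
Lemma pairwise_moment_ge (phi : R -> R) : measurable_fun [set: R] phi ->
  (forall x, 0 <= phi x) ->
  (forall x, (phi x)%:E <= \int[mu]_y (f y * `|y - x| `^ a)%:E)%E ->
  (\int[mu]_x (f x * phi x)%:E <=
   \int[mu2]_z (f z.1 * (f z.2 * `|z.2 - z.1| `^ a))%:E)%E.
Proof.
move=> mphi phi0 hphi.
have mp : measurable_fun [set: R] (fun x => f x * phi x) by exact: measurable_funM.
have p0 x : 0 <= f x * phi x by exact: mulr_ge0.
have -> : (\int[mu]_x (f x * phi x)%:E = \int[mu2]_z (f z.1 * phi z.1 * f z.2)%:E)%E.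
  by rewrite (double_integral_prod (fun x => f x * phi x) f)// ?f1 ?mule1// ltry.
apply: double_integral_le_inner.
- exact: (measurable_funM (measurable_fst_comp _ mp) (measurable_snd_comp _ mf)).
- apply: (measurable_funM (measurable_fst_comp _ mf)).
  apply: (measurable_funM (measurable_snd_comp _ mf)).
  apply: (measurable_sub_comp (fun u => `|u| `^ a)).
  by apply: (measurableT_comp (@measurable_powR R a)).
- by move=> z; rewrite mulr_ge0.
- by move=> z; rewrite mulr_ge0// mulr_ge0// powR_ge0.
- move=> x /=; rewrite ge0_integralZl_real// f1 mule1 ge0_integralZl_real//.
  + by rewrite EFinM lee_wpmul2l// lee_fin.
  + by apply: measurable_funM => //; exact: measurable_norm_powR.
  + by move=> y _; rewrite mulr_ge0 ?powR_ge0.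
Qed.

(** The passage from [r < f m] to [f m]: otherwise the midpoint of [K / s] and [f m] is an
    admissible [r] violating the hypothesis. *)
Lemma sup_sigma_le (m K : R) : log_concave f -> 0 <= K ->
  (forall r, 0 < r -> r < f m -> r * s <= K) -> f m * s <= K.
Proof.
move=> lc K0 H; rewrite leNgt; apply/negP => Km.
have s0 := sigma_gt0.
have Ks : K / s < f m by rewrite ltr_pdivrMr.
have Ks0 : 0 <= K / s by rewrite divr_ge0// ltW.
have := H ((K / s + f m) / 2) _ _.
rewrite -ler_pdivlMr// => H'.
have : (K / s + f m) / 2 <= K / s by apply: H'; lra.
by lra.
Qed.

Lemma sup_sigma_Dconst (m : R) : log_concave f -> f m * s <= Dconst a.
Proof.
move=> lc; apply: sup_sigma_le => //; first exact: powR_ge0.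
move=> r r0 rm; have s0 := sigma_ge0.
have := pairwise_moment a m r f a1 hf lc r0 rm.
have h := pairwise_moment_ge (fun x => `|x - c| `^ a) (measurable_norm_powR _ _)
  (fun x => powR_ge0 _ _) jensen_pdf.
move=> /(le_trans h); rewrite central_moment_pdf lee_fin => H.
have rs0 : 0 <= r * s by rewrite mulr_ge0// ltW.
rewrite -[r * s](powRr1 rs0) -(@mulfV _ a) ?gt_eqF// powRrM /Dconst.
apply: ge0_ler_powR; rewrite ?nnegrE ?invr_ge0 ?(ltW a0) ?powR_ge0 ?Gamma_ge0//.
rewrite powRM ?(ltW r0)//.
have ra0 : 0 < r `^ a by rewrite powR_gt0.
have rr : r `^ a * r^-1 `^ a = 1.
  by rewrite -powRM ?invr_ge0 ?(ltW r0)// mulfV ?gt_eqF// powR1.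
have := ler_wpM2l (ltW ra0) H.
by rewrite [leRHS]mulrCA rr mulr1.
Qed.

(** The square is expanded around [c]; the cross term vanishes because [c] is the mean. Against
    [jensen_pdf] the gain is the term [s^2]. *)
Lemma second_moment_pdf (x : R) : a = 2 ->
  ((`|x - c| `^ 2 + s `^ 2)%:E <= \int[mu]_y (f y * `|y - x| `^ a)%:E)%E.
Proof.
move=> a2.
rewrite -(ge0_expectation_pdf P X f hf hX (fun y => `|y - x| `^ a)); last 2 first.
- exact: measurable_norm_powR.
- by move=> y; exact: powR_ge0.
have i1 := integrable_central_moment.
have i2 : P.-integrable [set: T] (fun t => ((2 * (c - x))%:E * (X t)%:E)%E).
  by apply: integrableZl => //; exact: integrable_RV.
have i3 := finite_measure_integrable_cst P ((x - c) ^+ 2 - 2 * (c - x) * c)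
  (measurableT : measurable [set: T]).
rewrite (eq_integral (fun t => ((`|X t - c| `^ a)%:E +
    ((2 * (c - x))%:E * (X t)%:E + (cst ((x - c) ^+ 2 - 2 * (c - x) * c) t)%:E))%E)).
  rewrite integralD//; last exact: integrableD.
  rewrite integralD//.
  rewrite integralZl//; last exact: integrable_RV.
  have -> : (\int[P]_t (cst ((x - c) ^+ 2 - 2 * (c - x) * c) t)%:E =
      ((x - c) ^+ 2 - 2 * (c - x) * c)%:E)%E.
    have := integral_cst P measurableT ((x - c) ^+ 2 - 2 * (c - x) * c)%:E.
    by rewrite /= probability_setT mule1.
  rewrite expectation_fine.
  have -> : (\int[P]_t (`|X t - c| `^ a)%:E = (s `^ a)%:E)%E.
    rewrite -central_moment_pdf.
    rewrite (ge0_expectation_pdf P X f hf hX (fun x => `|x - c| `^ a))//.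
    exact: measurable_norm_powR.
  rewrite -EFinM -!EFinD lee_fin a2 powR_mulrn// real_normK ?num_real//.
  by rewrite le_eqVlt; apply/orP; left; apply/eqP; ring.
move=> t _ /=; rewrite -EFinM -!EFinD; congr EFin.
by rewrite a2 !powR_mulrn// !real_normK ?num_real//; ring.
Qed.

(** Averaging [second_moment_pdf] gives [2 s^2] on the left, and this 2 cancels the bound 2 on
    [Gamma 3]. *)
Lemma sup_sigma_le1 (m : R) : a = 2 -> log_concave f -> f m * s <= 1.
Proof.
move=> a2 lc; apply: sup_sigma_le => // r r0 rm; have s0 := sigma_ge0.
have := pairwise_moment a m r f a1 hf lc r0 rm.
have mphi : measurable_fun [set: R] (fun x => `|x - c| `^ 2 + s `^ 2).
  by apply: measurable_funD => //; exact: measurable_norm_powR.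
have := pairwise_moment_ge (fun x => `|x - c| `^ 2 + s `^ 2) mphi
  (fun x => addr_ge0 (powR_ge0 _ _) (powR_ge0 _ _)) (fun x => second_moment_pdf x a2).
move=> /le_trans H /H; under eq_integral do rewrite mulrDr.
rewrite ge0_integralD_real//; last 4 first.
- by apply: measurable_funM => //; exact: measurable_norm_powR.
- exact: measurable_funM.
- by move=> y _; rewrite mulr_ge0 ?powR_ge0.
- by move=> y _; rewrite mulr_ge0 ?powR_ge0.
under [X in (_ + X)%E]eq_integral do rewrite mulrC.
rewrite ge0_integralZl_real ?powR_ge0// f1 mule1.
have := central_moment_pdf; rewrite {1}a2 => ->.
set ss := fine (sigma X a) in s0 *.
rewrite a2 -EFinD lee_fin !powR_mulrn ?invr_ge0 ?(ltW r0)// => {}H.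
have G3 : Gamma (2 + 1) <= 2 :> R.
  by have := @Gamma3_le2 R; rewrite (_ : 3 = 2 + 1 :> R)//; lra.
have rr : r ^+ 2 * r^-1 ^+ 2 = 1 by rewrite -exprMn mulfV ?expr1n// gt_eqF.
have rV : 0 <= r^-1 ^+ 2 by rewrite sqr_ge0.
have H2 : ss ^+ 2 <= r^-1 ^+ 2 by have := ler_wpM2r rV G3; lra.
have H3 := ler_wpM2l (sqr_ge0 r) H2.
rewrite rr in H3.
rewrite -(@ler_pXn2r _ 2) ?nnegrE ?mulr_ge0 ?(ltW r0)//.
by rewrite expr1n exprMn.
Qed.

End standard_deviation.

(** * The maximum entropy lower bound *)

Section entropy.
Context {R : realType}.
Local Notation mu := (@lebesgue_measure R).

Lemma integral_even (h : R -> R) : measurable_fun [set: R] h -> (forall x, 0 <= h x) ->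
  (\int[mu]_x (h `|x|)%:E = 2%:E * \int[mu]_(u in `]0%R, +oo[) (h u)%:E)%E.
Proof.
move=> mh h0.
have mhn : measurable_fun [set: R] (fun x => h `|x|) by apply: measurableT_comp.
have mpn : measurable_fun [set: R] (fun x => ind_gt0 x * h `|x|).
  by apply: measurable_funM => //; exact: measurable_ind_gt0.
have mnp : measurable_fun [set: R] (fun x => ind_ge0 (- x) * h `|x|).
  apply: measurable_funM => //; apply: (measurableT_comp (@measurable_ind_ge0 R)).
  exact: oppr_measurable.
have hn0 x : 0 <= h `|x| by [].
have e1 : (\int[mu]_x (ind_gt0 x * h `|x|)%:E = \int[mu]_(u in `]0%R, +oo[) (h u)%:E)%E.
  transitivity (\int[mu]_x (ind_gt0 (x - 0) * h `|x|)%:E)%E.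
    by apply: eq_integral => x _; rewrite subr0.
  rewrite (integral_ind_gt0_shift 0 (fun x => h `|x|))//.
  by apply: eq_integral => u; rewrite inE/= in_itv/= andbT => u0; rewrite add0r gtr0_norm.
have e2 : (\int[mu]_x (ind_ge0 (- x) * h `|x|)%:E = \int[mu]_(u in `]0%R, +oo[) (h u)%:E)%E.
  rewrite ge0_integral_oppr//; last 2 first.
  - exact/measurable_EFinP.
  - by move=> x; rewrite lee_fin mulr_ge0 ?ind_ge0_ge0.
  transitivity (\int[mu]_x (ind_ge0 (x - 0) * h `|x|)%:E)%E.
    by apply: eq_integral => x _; rewrite subr0 opprK normrN.
  rewrite (integral_ind_ge0_shift 0 (fun x => h `|x|))//.
  by apply: eq_integral => u; rewrite inE/= in_itv/= andbT => u0; rewrite add0r gtr0_norm.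
rewrite mule_natl mule2n -{1}e1 -e2 -ge0_integralD_real//.
- apply: eq_integral => x _; congr EFin; rewrite -mulrDl /ind_gt0 /ind_ge0 oppr_ge0.
  by case: ltP => _; rewrite ?addr0 ?add0r mul1r.
- by move=> x _; rewrite mulr_ge0 ?ind_gt0_ge0.
- by move=> x _; rewrite mulr_ge0 ?ind_ge0_ge0.
Qed.

(** In the form of [integral_expRN_powR], the integrand is at least [e^(-1)] on []0, 1]]. *)
Lemma Gamma_inv_gt0 (a : R) : 1 <= a -> 0 < Gamma a^-1 :> R.
Proof.
move=> a1; have a0 : 0 < a by lra.
suff : (0 < (Gamma a^-1 / a)%:E :> \bar R)%E by rewrite lte_fin pmulr_lgt0// invr_gt0.
rewrite -integral_expRN_powR//.
have mG : measurable_fun [set: R] (fun u : R => expR (- (u `^ a))).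
  apply: measurableT_comp; first exact: measurable_expR.
  apply: measurableT_comp; first exact: oppr_measurable.
  exact: measurable_powR.
apply: (@lt_le_trans _ _ (\int[mu]_(u in `]0%R, 1%R]) (cst (expR (-1))%:E u))%E).
  rewrite integral_cst//= lebesgue_measure_itv/= lte_fin ltr01 oppr0 addr0 mule1.
  by rewrite lte_fin expR_gt0.
apply: (@le_trans _ _ (\int[mu]_(u in `]0%R, 1%R]) (expR (- (u `^ a)))%:E)%E).
  apply: ge0_le_integral_real => //.
  move=> u /=; rewrite in_itv/= => /andP[u0 u1]; rewrite ler_expR lerN2.
  have e : 1 = 1 `^ a :> R by rewrite powR1.
  by rewrite [leRHS]e; apply: ge0_ler_powR; rewrite ?nnegrE// ltW.
apply: ge0_subset_integral => //.
- by apply/measurable_EFinP; exact: measurable_funTS.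
- by move=> u /=; rewrite !in_itv/= andbT => /andP[].
Qed.

Lemma Cconst_gt0 (a : R) : 1 <= a -> 0 < Cconst a.
Proof.
move=> a1; rewrite /Cconst mulr_gt0//; first by rewrite mulr_gt0 ?Gamma_inv_gt0// divr_gt0//; lra.
by rewrite powR_gt0// mulr_gt0 ?expR_gt0//; lra.
Qed.

(** The origin of [Cconst]. Scaling by [tau = a^(1/a) s] yields the mass [2 tau Gamma(1/a) / a]; the
    extra [e^(1/a)] inside [Cconst] is compensated here and reappears in [g] below. *)
Lemma integral_gen_gauss (a s c : R) : 1 <= a -> 0 < s ->
  (\int[mu]_x (expR (- (`|x - c| `^ a / (a * s `^ a))))%:E =
   (Cconst a * s * expR (- a^-1))%:E)%E.
Proof.
move=> a1 s0; have a0 : 0 < a by lra.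
have mE : measurable_fun [set: R] (fun u : R => expR (- (u `^ a))).
  apply: measurableT_comp; first exact: measurable_expR.
  apply: measurableT_comp; first exact: oppr_measurable.
  exact: measurable_powR.
pose tau := a `^ a^-1 * s.
have tau0 : 0 < tau by rewrite mulr_gt0// powR_gt0.
have tauE : tau `^ a = a * s `^ a.
  rewrite /tau powRM ?powR_ge0 ?(ltW s0)// -powRrM mulVf ?gt_eqF//.
  by rewrite powRr1// ltW.
have mF : measurable_fun [set: R] (fun x => expR (- (`|x - c| `^ a / (a * s `^ a)))).
  apply: measurableT_comp; first exact: measurable_expR.
  apply: measurableT_comp; first exact: oppr_measurable.
  by apply: measurable_funM => //; exact: measurable_norm_powR.
rewrite (ge0_integral_affine tau c)//; last exact/measurable_EFinP.
under eq_integral => x _.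
  rewrite addrK normrM (gtr0_norm tau0) powRM ?(ltW tau0)// -tauE.
  rewrite [X in expR (- X)](_ : _ = `|x| `^ a); last first.
    by rewrite mulrAC divff ?mul1r// gt_eqF// powR_gt0.
  over.
rewrite (integral_even (fun u => expR (- (u `^ a))))//.
rewrite integral_expRN_powR// -!EFinM; congr EFin.
rewrite /Cconst powRM ?expR_ge0 ?(ltW a0)// -expRM mul1r.
have : expR a^-1 * expR (- a^-1) = 1 by exact: expRxMexpNx_1.
rewrite /tau; set e1 := expR a^-1; set e2 := expR (- a^-1) => e12.
transitivity (2 / a * Gamma a^-1 * a `^ a^-1 * s * (e1 * e2)); last by ring.
by rewrite e12; ring.
Qed.

(** For [t = f x > 0] and [L = ln(t / S)], multiply [1 + (q - 1) L <= e^((q - 1) L)] by [t] and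
    [1 + (l - k - L) <= g / t] by [(q - 1) t]. In the sum [L] cancels; moving [k] to the right
    leaves nonnegative terms on both sides when [l >= 0]. *)
Lemma entropy_pointwise (q t S g k l : R) : 1 < q -> 0 <= t -> 0 < S -> 0 <= k ->
  g = S * expR (l - k) ->
  t + (q - 1) * (t + t * l) <= S^-1 `^ (q - 1) * t `^ q + (q - 1) * (g + t * k).
Proof.
move=> q1 t0 S0 k0 gE.
have g0 : 0 <= g by rewrite gE mulr_ge0 ?expR_ge0// ltW.
have qm : 0 < q - 1 by lra.
have [->|tN0] := eqVneq t 0.
  rewrite !mul0r !addr0 mulr0 addr0.
  by apply: addr_ge0; apply: mulr_ge0; rewrite ?powR_ge0// ltW.
have tp : 0 < t by rewrite lt_neqAle eq_sym tN0.
pose L := ln (t / S).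
have tS : 0 < t / S by rewrite divr_gt0.
have EL : expR L = t / S by rewrite /L lnK ?posrE.
have e1 : S^-1 `^ (q - 1) * t `^ q = t * expR (L * (q - 1)).
  rewrite expRM EL powRM ?invr_ge0 ?(ltW S0)// -(mulr_powRB1 t0); last by lra.
  by ring.
have h1 : 1 + L * (q - 1) <= expR (L * (q - 1)) by exact: expR_ge1Dx.
have e2 : g = t * expR (l - k - L).
  rewrite expRB EL gE invf_div; field; exact: tN0.
have h2 : 1 + (l - k - L) <= expR (l - k - L) by exact: expR_ge1Dx.
have := ler_wpM2l t0 h1; have := ler_wpM2l (mulr_ge0 (ltW qm) t0) h2.
rewrite e1 e2.
set E1 := expR _; set E2 := expR _ => H2 H1.
have -> : t + (q - 1) * (t + t * l) =
  t * (1 + L * (q - 1)) + (q - 1) * t * (1 + (l - k - L)) + (q - 1) * (t * k) by ring.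
have -> : t * E2 + (q - 1) * (t * E1 + t * k) =
  t * E2 + (q - 1) * t * E1 + (q - 1) * (t * k) by ring.
by rewrite lerD2r; exact: lerD.
Qed.

Lemma integral_powR_ge (f : R -> R) (a s c q : R) : 1 <= a -> is_pdf f -> 0 < s -> 1 < q ->
  (\int[mu]_x (f x * `|x - c| `^ a)%:E = (s `^ a)%:E)%E ->
  (((Cconst a * s)^-1 `^ (q - 1))%:E <= \int[mu]_x (f x `^ q)%:E)%E.
Proof.
move=> a1 [mf f0 f1] s0 q1 hs; have a0 : 0 < a by lra.
have C0 := Cconst_gt0 a a1.
have Cs0 : 0 < Cconst a * s by rewrite mulr_gt0.
pose S := (Cconst a * s)^-1; have S0 : 0 < S by rewrite invr_gt0.
pose k x := `|x - c| `^ a / (a * s `^ a).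
have as0 : 0 < a * s `^ a by rewrite mulr_gt0// powR_gt0.
have k0 x : 0 <= k x by rewrite divr_ge0 ?powR_ge0// ltW.
(* The shift [1/a] normalises [g], and it is also the mean of [k] under [f]. *)
pose g x := S * expR (a^-1 - k x).
have g0 x : 0 <= g x by rewrite mulr_ge0 ?expR_ge0// ltW.
have mk : measurable_fun [set: R] k.
  by apply: measurable_funM => //; exact: measurable_norm_powR.
have mek : measurable_fun [set: R] (fun x => expR (- k x)).
  apply: measurableT_comp; first exact: measurable_expR.
  by apply: measurableT_comp => //; exact: oppr_measurable.
have gE x : g x = S * expR a^-1 * expR (- k x) by rewrite /g expRD mulrA.
have mg : measurable_fun [set: R] g.
  by rewrite (_ : g = fun x => S * expR a^-1 * expR (- k x));
    [exact: measurable_funM|apply/funext].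
have ig : (\int[mu]_x (g x)%:E = 1)%E.
  have Se0 : 0 <= S * expR a^-1 by rewrite mulr_ge0 ?expR_ge0// ltW.
  under eq_integral do rewrite gE.
  rewrite ge0_integralZl_real//.
  rewrite integral_gen_gauss// -EFinM; congr EFin.
  have e12 : expR a^-1 * expR (- a^-1) = 1 by exact: expRxMexpNx_1.
  transitivity (S * (Cconst a * s) * (expR a^-1 * expR (- a^-1))); first by ring.
  by rewrite e12 mulr1 mulVf// gt_eqF.
have mfk : measurable_fun [set: R] (fun x => f x * k x) by exact: measurable_funM.
have fk0 x : 0 <= f x * k x by exact: mulr_ge0.
have ifk : (\int[mu]_x (f x * k x)%:E = (a^-1)%:E)%E.
  have mfn : measurable_fun [set: R] (fun x => f x * `|x - c| `^ a).
    by apply: measurable_funM => //; exact: measurable_norm_powR.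
  have fn0 x : 0 <= f x * `|x - c| `^ a by rewrite mulr_ge0 ?powR_ge0.
  have asV0 : 0 <= (a * s `^ a)^-1 by rewrite invr_ge0 ltW.
  under eq_integral do rewrite /k mulrA mulrC.
  rewrite ge0_integralZl_real//.
  rewrite hs -EFinM; congr EFin; field.
  by rewrite !gt_eqF// powR_gt0.
have qm : 0 < q - 1 by lra.
have mfq : measurable_fun [set: R] (fun x => f x `^ q).
  exact: (measurableT_comp (@measurable_powR R q) mf).
have Sq : 0 < S^-1 `^ (q - 1) by rewrite powR_gt0// invr_gt0.
have mfl : measurable_fun [set: R] (fun x => f x * a^-1) by exact: measurable_funM.
have mfd : measurable_fun [set: R] (fun x => f x + f x * a^-1) by exact: measurable_funD.
have mgk : measurable_fun [set: R] (fun x => g x + f x * k x) by exact: measurable_funD.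
have aV0 : 0 <= a^-1 by rewrite invr_ge0 ltW.
have fl0 x : 0 <= f x * a^-1 by exact: mulr_ge0.
have fd0 x : 0 <= f x + f x * a^-1 by exact: addr_ge0.
have gk0 x : 0 <= g x + f x * k x by exact: addr_ge0.
have mqfd : measurable_fun [set: R] (fun x => (q - 1) * (f x + f x * a^-1)).
  exact: measurable_funM.
have mqgk : measurable_fun [set: R] (fun x => (q - 1) * (g x + f x * k x)).
  exact: measurable_funM.
have mSfq : measurable_fun [set: R] (fun x => S^-1 `^ (q - 1) * f x `^ q).
  exact: measurable_funM.
have qfd0 x : 0 <= (q - 1) * (f x + f x * a^-1) by rewrite mulr_ge0// ltW.
have qgk0 x : 0 <= (q - 1) * (g x + f x * k x) by rewrite mulr_ge0// ltW.
have Sfq0 x : 0 <= S^-1 `^ (q - 1) * f x `^ q by rewrite mulr_ge0 ?powR_ge0.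
have : (\int[mu]_x (f x + (q - 1) * (f x + f x * a^-1))%:E <=
   \int[mu]_x (S^-1 `^ (q - 1) * f x `^ q + (q - 1) * (g x + f x * k x))%:E)%E.
  apply: ge0_le_integral_real => //.
  - exact: measurable_funD.
  - exact: measurable_funD.
  - by move=> x _; exact: addr_ge0.
  - by move=> x _; exact: entropy_pointwise.
rewrite !ge0_integralD_real// !(ge0_integralZl_real _ (q - 1))// ?(ltW qm)//.
rewrite !ge0_integralD_real// ig ifk f1.
have -> : (\int[mu]_x (f x * a^-1)%:E = (a^-1)%:E)%E.
  by under eq_integral do rewrite mulrC; rewrite ge0_integralZl_real// f1 mule1.
(* Both sides carry the same term [(q - 1) (1 + 1/a)]; cancelling it leaves [1 <= S^(1-q)] times the
   integral of [f^q]. *)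
rewrite leeD2rE// ge0_integralZl_real ?(ltW Sq)//; last first.
  by move=> x _; exact: powR_ge0.
move=> H.
have Sq0 : 0 <= S `^ (q - 1) by exact: powR_ge0.
have SV0 : 0 <= S^-1 by rewrite invr_ge0 ltW.
have SS : S `^ (q - 1) * S^-1 `^ (q - 1) = 1.
  by rewrite -(powRM _ (ltW S0) SV0) mulfV ?gt_eqF// powR1.
have := lee_wpmul2l (_ : (0 <= (S `^ (q - 1))%:E)%E) H.
rewrite lee_fin => /(_ Sq0); rewrite mule1 muleA -EFinM.
by rewrite SS mul1e.
Qed.

End entropy.

(** * Comparison of the norms *)

Section norm_comparison.
Context {R : realType}.
Local Notation mu := (@lebesgue_measure R).

Lemma rinv_EFin (r : R) : r != 0 -> rinv r%:E = r^-1.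
Proof. by move=> r0; rewrite /rinv inver (negbTE r0). Qed.

Lemma rinv_pinfty : rinv (+oo%E : \bar R) = 0.
Proof. by rewrite /rinv invey. Qed.

Lemma pnorm_EFin (f : R -> R) (r : R) : (forall x, 0 <= f x) ->
  (pnorm r%:E f = (\int[mu]_x (f x `^ r)%:E) `^ r^-1)%E.
Proof.
move=> f0; rewrite /pnorm unlock; congr (_ `^ _)%E.
by apply: eq_integral => x _; rewrite /= ger0_norm.
Qed.

Lemma lebesgue_measureT_gt0 : (0 < mu [set: R])%E.
Proof. by rewrite -set_itvNyy lebesgue_measure_itv/= adde_gt0. Qed.

Lemma pnorm_pinfty (f : R -> R) : (forall x, 0 <= f x) ->
  pnorm +oo%E f = ess_sup mu (EFin \o f).
Proof.
move=> f0; rewrite /pnorm unlock lebesgue_measureT_gt0.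
by congr ess_sup; apply/funext => x /=; rewrite ger0_norm.
Qed.

(** Pointwise [f^r <= M^(r-1) f], and [f] has integral 1. *)
Lemma pnorm_le (f : R -> R) (M : R) (p : \bar R) : is_pdf f ->
  (forall x, f x <= M) -> (1 <= p)%E -> (pnorm p f <= (M `^ (1 - rinv p))%:E)%E.
Proof.
move=> [mf f0 f1] fM; have M0 : 0 <= M by exact: le_trans (f0 0) (fM 0).
case: p => [r| |//]; last first.
  move=> _; rewrite rinv_pinfty subr0 powRr1// pnorm_pinfty//.
  by apply/ess_supP; apply: aeW => x; rewrite lee_fin.
rewrite lee_fin => r1; have r0 : 0 < r by lra.
rewrite rinv_EFin ?gt_eqF// pnorm_EFin//.
have H : (\int[mu]_x (f x `^ r)%:E <= (M `^ (r - 1))%:E)%E.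
  rewrite -[leRHS]mule1 -f1 -ge0_integralZl_real ?powR_ge0//.
  apply: ge0_le_integral_real => //.
  - exact: (measurableT_comp (@measurable_powR R r) mf).
  - exact: measurable_funM.
  - by move=> x _; exact: powR_ge0.
  - move=> x _; rewrite -(mulr_powRB1 (f0 x) r0) mulrC ler_wpM2r//.
    by apply: ge0_ler_powR; rewrite ?nnegrE// subr_ge0.
apply: (@le_trans _ _ ((M `^ (r - 1))%:E `^ r^-1)%E).
  apply: gt0_ler_poweR => //; rewrite ?invr_ge0 ?(ltW r0)// ?in_itv/= ?leey ?andbT.
    by apply: integral_ge0 => x _; rewrite lee_fin powR_ge0.
  by rewrite lee_fin powR_ge0.
rewrite poweR_EFin -powRrM lee_fin (_ : (r - 1) * r^-1 = 1 - r^-1)//.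
by field; rewrite gt_eqF.
Qed.

Lemma pnorm_ge (f : R -> R) (S : R) (q : \bar R) : is_pdf f -> 0 < S ->
  (forall r, 1 < r -> ((S `^ (r - 1))%:E <= \int[mu]_x (f x `^ r)%:E)%E) ->
  (1 <= q)%E -> ((S `^ (1 - rinv q))%:E <= pnorm q f)%E.
Proof.
move=> [mf f0 f1] S0 H; case: q => [r| |//]; last first.
  move=> _; rewrite rinv_pinfty subr0 powRr1 ?(ltW S0)//.
  have := Lnorm_ge0 mu +oo%E (EFin \o f); rewrite -/(pnorm _ _) pnorm_pinfty//.
  have := ess_sup_ge mu (EFin \o f).
  case: (ess_sup mu (EFin \o f)) => [n|_ _|_ //]; last exact: leey.
  rewrite lee_fin => fn n0.
  (* For [q = +oo] the exponent 2 suffices: [S <=] integral of [f^2] [<= n], where [n] is the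
     essential supremum. *)
  have h2 : (\int[mu]_x (f x `^ 2)%:E <= n%:E)%E.
    rewrite -[leRHS]mule1 -f1 -ge0_integralZl_real//.
    apply: ae_ge0_le_integral => //.
    - by move=> x _; rewrite lee_fin powR_ge0.
    - by apply/measurable_EFinP; exact: (measurableT_comp (@measurable_powR R 2) mf).
    - by move=> x _; rewrite lee_fin mulr_ge0.
    - by apply/measurable_EFinP; exact: measurable_funM.
    - apply: filterS fn => x /= fxn _; rewrite lee_fin powR_mulrn// expr2.
      by rewrite ler_wpM2r// -lee_fin.
  have two1 : 1 < 2 :> R by lra.
  have := le_trans (H 2 two1) h2.
  by rewrite (_ : 2 - 1 = 1 :> R) ?powRr1 ?(ltW S0)//; lra.
rewrite lee_fin => r1; have r0 : 0 < r by lra.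
rewrite rinv_EFin ?gt_eqF//.
have [->|rN1] := eqVneq r 1.
  rewrite invr1 subrr powRr0 /pnorm Lnorm1.
  under eq_integral => x _ do rewrite /= ger0_norm//.
  by rewrite f1.
have r_gt1 : 1 < r by rewrite lt_neqAle eq_sym rN1.
rewrite pnorm_EFin//.
apply: (@le_trans _ _ ((S `^ (r - 1))%:E `^ r^-1)%E).
  rewrite poweR_EFin -powRrM lee_fin (_ : (r - 1) * r^-1 = 1 - r^-1)//.
  by field; rewrite gt_eqF.
apply: gt0_ler_poweR; rewrite ?invr_ge0 ?(ltW r0)// ?in_itv/= ?leey ?andbT.
- by rewrite lee_fin powR_ge0.
- by apply: integral_ge0 => x _; rewrite lee_fin powR_ge0.
- exact: H.
Qed.

(** The upper bound with [M = K / s] is exactly the stated factor times the lower bound with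
    [S = 1 / (C s)]. Keeping [K] abstract covers both [Dconst] and 1. *)
Lemma pnorm_comparison (f : R -> R) (C K s : R) (p q : \bar R) : is_pdf f ->
  0 < C -> 0 <= K -> 0 < s -> (forall x, f x * s <= K) ->
  (forall r, 1 < r -> (((C * s)^-1 `^ (r - 1))%:E <= \int[mu]_x (f x `^ r)%:E)%E) ->
  (1 <= p)%E -> (1 <= q)%E ->
  (pnorm p f <=
   (C `^ (1 - rinv q) * K `^ (1 - rinv p) * s `^ (rinv p - rinv q))%:E * pnorm q f)%E.
Proof.
move=> hf C0 K0 s0 fK H p1 q1.
have Cs0 : 0 < (C * s)^-1 by rewrite invr_gt0 mulr_gt0.
have fM x : f x <= K / s by rewrite ler_pdivlMr.
apply: (le_trans (pnorm_le f (K / s) p hf fM p1)).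
have E0 : 0 <= C `^ (1 - rinv q) * K `^ (1 - rinv p) * s `^ (rinv p - rinv q).
  by rewrite !mulr_ge0 ?powR_ge0.
apply: le_trans (lee_wpmul2l _ (pnorm_ge f _ q hf Cs0 H q1)); last by rewrite lee_fin.
rewrite -EFinM lee_fin le_eqVlt; apply/orP; left; apply/eqP.
have V (x e : R) : 0 < x -> x^-1 `^ e = x `^ (- e).
  by move=> x0; rewrite -powR_inv1 ?(ltW x0)// -powRrM mulN1r.
have D (x e e' : R) : 0 < x -> x `^ e * x `^ e' = x `^ (e + e').
  by move=> x0; rewrite powRD// (gt_eqF x0) implybT.
rewrite powRM ?invr_ge0 ?(ltW s0)// !V ?mulr_gt0// powRM ?(ltW C0) ?(ltW s0)//.
set e := 1 - rinv q; set e' := 1 - rinv p.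
transitivity (K `^ e' * ((C `^ e * C `^ (- e)) *
  (s `^ (rinv p - rinv q) * s `^ (- e)))); last by ring.
rewrite !D// subrr powRr0 mul1r; congr (_ * s `^ _).
by rewrite /e /e'; ring.
Qed.

End norm_comparison.

Theorem theorem1 (R : realType) (alpha : R) (halpha : 1 <= alpha)
    (f : R -> R) (hpdf : is_pdf f) (hlc : log_concave f)
    (d : measure_display) (T : measurableType d) (P : probability T R)
    (X : {RV P >-> R}) (hX : has_pdf X f)
    (hsigma : sigma X alpha \is a fin_num) :
  (forall p q : \bar R, (1 <= p)%E -> (1 <= q)%E ->
     (pnorm p f <=
        (Cconst alpha `^ (1 - rinv q) * Dconst alpha `^ (1 - rinv p)
         * fine (sigma X alpha) `^ (rinv p - rinv q))%:E * pnorm q f)%E)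
  /\
  (alpha = 2 -> forall p q : \bar R, (1 <= p)%E -> (1 <= q)%E ->
     (pnorm p f <=
        (Cconst (2 : R) `^ (1 - rinv q)
         * fine (sigma X 2) `^ (rinv p - rinv q))%:E * pnorm q f)%E).
Proof.
have s0 := sigma_gt0 P X f alpha halpha hpdf hX hsigma.
have C0 := Cconst_gt0 alpha halpha.
have H (r : R) (r1 : 1 < r) := integral_powR_ge f alpha _ _ r halpha hpdf s0 r1
  (central_moment_pdf P X f alpha halpha hpdf hX hsigma).
split.
  move=> p q p1 q1; apply: pnorm_comparison => //; first exact: powR_ge0.
  by move=> x; exact: sup_sigma_Dconst.
move=> a2 p q p1 q1.
have := pnorm_comparison f _ 1 _ p q hpdf C0 ler01 s0
  (fun x => sup_sigma_le1 P X f alpha halpha hpdf hX hsigma x a2 hlc) H p1 q1.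
rewrite -a2; move: (Cconst alpha) (fine (sigma X alpha)) => c s.
by rewrite powR1 mulr1.
Qed.
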